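(* Let $\Delta\ge2$ be an integer and $\Lambda$ a real constant. Let $G=(V,E,w)$ be a weighted tree with $|V|=n\ge2$, weights $w:E\to\mathbb{R}_{>0}$, and maximum degree at most $\Delta$. Suppose that for every $S\subseteq V$ with $G[S]$ connected and $|S|\ge2$ there is an edge $e_S\in E(G[S])$ whose removal from the tree $G[S]$ produces components $A$ and $B$ (vertex sets) satisfying $$\max\{|A|-1,|B|-1\}\le\left(1-\frac1\Delta\right)(|S|-1)$$ and which also satisfies $$w_{e_S}\le\Lambda\,\frac{W(S)}{|S|-1}.$$ Put $$H_{n,\Delta}=1+\left\lfloor\log_{\Delta/(\Delta-1)}(n-1)\right\rfloor .$$ Then a hierarchy $T$ on $V$ satisfying $$\operatorname{cost}_D^-(T)\le\Lambda H_{n,\Delta}W\le\Lambda H_{n,\Delta}\operatorname{OPT}_{\mathrm{free}}(G,w)\le\Lambda H_{n,\Delta}\operatorname{OPT}_{\mathrm{card}}(G,w)$$ can be constructed in $O(nH_{n,\Delta})$ time. In particular, the running time is $O(n\log n)$ for fixed $\Delta$.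
   Context: $W=\sum_{e\in E}w_e$ and $W(S)=\sum_{xy\in E(G[S])}w_{xy}$. A (rooted binary) hierarchy $T$ on $V$ is a rooted tree whose leaves are the vertices of $V$ and whose internal nodes have exactly two children; $C_T(x,y)$ is the set of leaves below the lowest common ancestor of $x,y$, and $\operatorname{cost}_D^-(T)=\sum_{xy\in E}w_{xy}(|C_T(x,y)|-1)$. $d_G$ is the shortest-path metric of $(V,E)$ with every edge of length $1$ (weights are not lengths). $\operatorname{OPT}_{\mathrm{free}}(G,w)$ is the minimum of $\sum_{xy\in E}w_{xy}u(x,y)$ over all ultrametrics $u$ on $V$ (metrics with $u(x,y)\le\max\{u(x,z),u(z,y)\}$) with $u\ge d_G$ on all pairs. Put $h_T(x,x)=0$ and $h_T(x,y)=|C_T(x,y)|-1$ for $x\ne y$; $\operatorname{OPT}_{\mathrm{card}}(G,w)$ is the minimum of $\sum_{xy\in E}w_{xy}h_T(x,y)$ over all rooted binary hierarchies $T$ on $V$ with $h_T\ge d_G$ on all pairs. The algorithmic problem: the input is the weighted tree $G$ (as adjacency lists with weights) and $\Delta$, the output is $T$; time is the number of elementary operations, with arithmetic and comparisons on integers and weights at unit cost. *)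

(* Defs.v *)
From HB Require Import structures.
From mathcomp Require Import all_boot all_order all_algebra.
From mathcomp Require Import all_classical all_reals all_analysis.

Set Implicit Arguments.
Unset Strict Implicit.
Unset Printing Implicit Defensive.

Import Order.TTheory GRing.Theory Num.Theory.
Local Open Scope ring_scope.

(** * Weighted graphs *)

(* Vertices are numbered 0, ..., n-1; the numbering is arbitrary and is the one
   by which the machine below refers to vertices. The values of [wt] outside of
   the edges are irrelevant. *)
Record wgraph (R : realType) (n : nat) := WGraph {
  adj : rel 'I_n;
  wt : 'I_n -> 'I_n -> R;
  adj_sym : symmetric adj;
  adj_irr : irreflexive adj;
  wt_sym : forall x y, adj x y -> wt x y = wt y x;
  wt_gt0 : forall x y, adj x y -> 0 < wt x y }.

Section Graphs.
Variables (R : realType) (n : nat) (G : wgraph R n).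
Implicit Types (e : rel 'I_n) (S : {set 'I_n}).

(* For an irreflexive relation, the duplicate-free cyclic sequences of size at
   most 2 are the empty one and the edges; the longer ones are the cycles of
   the graph. *)
Definition is_tree : Prop :=
  (forall x y, connect (adj G) x y) /\
  (forall c : seq 'I_n, ucycle (adj G) c -> (size c < 3)%N).

Definition max_degree_le (D : nat) : Prop :=
  forall x, (#|[set y | adj G x y]| <= D)%N.

(* Each unordered edge xy is listed once, with x < y. *)
Definition edge_sum (F : 'I_n -> 'I_n -> R) : R :=
  \sum_(p : 'I_n * 'I_n | (p.1 < p.2)%N && adj G p.1 p.2) F p.1 p.2.

Definition total_weight : R := edge_sum (wt G).

Definition induced S : rel 'I_n :=
  [rel x y | [&& x \in S, y \in S & adj G x y]].

Definition connected_on S : Prop :=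
  forall x y, x \in S -> y \in S -> connect (induced S) x y.

Definition set_weight S : R :=
  \sum_(p : 'I_n * 'I_n | (p.1 < p.2)%N && induced S p.1 p.2) wt G p.1 p.2.

Definition remove_edge e (a b : 'I_n) : rel 'I_n :=
  [rel x y | [&& e x y, (x, y) != (a, b) & (x, y) != (b, a)]].

Definition component e (a : 'I_n) : {set 'I_n} := [set y | connect e a y].

Definition balanced_light_edges (D : nat) (Lambda : R) : Prop :=
  forall S, connected_on S -> (2 <= #|S|)%N ->
  exists a b : 'I_n,
    let A := component (remove_edge (induced S) a b) a in
    let B := component (remove_edge (induced S) a b) b in
    [/\ induced S a b,
        Num.max (#|A|%:R - 1) (#|B|%:R - 1)
          <= (1 - D%:R^-1) * (#|S|%:R - 1) :> R
      & wt G a b <= Lambda * (set_weight S / (#|S|%:R - 1))].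

(* The least length of a walk from x to y. The search range is enough because
   shortest walks have at most n - 1 edges; the value is n if there is no
   walk. *)
Definition dist (x y : 'I_n) : nat :=
  find (fun k => [exists p : k.-tuple 'I_n, path (adj G) x p && (last x p == y)])
       (iota 0 n).

End Graphs.

(** * Hierarchies *)

(* Children are ordered here, but no notion below depends on their order. *)
Inductive htree (V : Type) :=
| HLeaf of V
| HNode of htree V & htree V.

Fixpoint leaves (V : Type) (T : htree V) : seq V :=
  match T with
  | HLeaf v => [:: v]
  | HNode T1 T2 => leaves T1 ++ leaves T2
  end.

Definition is_hierarchy (n : nat) (T : htree 'I_n) : Prop :=
  perm_eq (leaves T) (enum 'I_n).

(* The subtree rooted at the lowest common ancestor of the leaves x and y. *)
Fixpoint lca_subtree (V : eqType) (T : htree V) (x y : V) : htree V :=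
  match T with
  | HLeaf v => T
  | HNode T1 T2 =>
      if (x \in leaves T1) && (y \in leaves T1) then lca_subtree T1 x y
      else if (x \in leaves T2) && (y \in leaves T2) then lca_subtree T2 x y
      else T
  end.

Definition cluster (n : nat) (T : htree 'I_n) (x y : 'I_n) : {set 'I_n} :=
  [set z in leaves (lca_subtree T x y)].

Section Costs.
Variables (R : realType) (n : nat) (G : wgraph R n).

Definition costD (T : htree 'I_n) : R :=
  edge_sum G (fun x y => wt G x y * (#|cluster T x y|%:R - 1)).

Definition is_metric (u : 'I_n -> 'I_n -> R) : Prop :=
  [/\ forall x y, 0 <= u x y,
      forall x y, u x y = 0 <-> x = y,
      forall x y, u x y = u y x
    & forall x y z, u x y <= u x z + u z y].

Definition is_ultrametric (u : 'I_n -> 'I_n -> R) : Prop :=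
  is_metric u /\ forall x y z, u x y <= Num.max (u x z) (u z y).

Definition dominates_dist (u : 'I_n -> 'I_n -> R) : Prop :=
  forall x y, (dist G x y)%:R <= u x y.

Definition ultra_cost (u : 'I_n -> 'I_n -> R) : R :=
  edge_sum G (fun x y => wt G x y * u x y).

Definition card_ultra (T : htree 'I_n) (x y : 'I_n) : R :=
  if x == y then 0 else #|cluster T x y|%:R - 1.

Definition is_min (A : R -> Prop) (m : R) : Prop :=
  A m /\ forall c, A c -> m <= c.

Definition is_OPT_free : R -> Prop :=
  is_min (fun c => exists u,
    [/\ is_ultrametric u, dominates_dist u & c = ultra_cost u]).

Definition is_OPT_card : R -> Prop :=
  is_min (fun c => exists T,
    [/\ is_hierarchy T, dominates_dist (card_ultra T)
      & c = ultra_cost (card_ultra T)]).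

End Costs.

Definition depth_bound (R : realType) (n D : nat) : int :=
  1 + Num.floor (ln (n%:R - 1 : R) / ln (D%:R / (D%:R - 1) : R)).

(** * Unit-cost random access machine

   A program is a finite piece of syntax: registers and arrays are named by
   numerals occurring in it, so it uses a fixed finite number of them, while
   array positions are computed at run time. Integers are natural numbers with
   truncated subtraction, weights are arbitrary reals that programs can only
   access through the operations below. Division is left out: it would only
   enlarge the class of programs. *)

Inductive arith_op := Add | Sub | Mul.

Inductive nexp :=
| NConst of nat
| NReg of nat
| NGet of nat & nexp              (* array, position *)
| NOp of arith_op & nexp & nexp.

Inductive wexp :=
| WReg of nat
| WGet of nat & nexp
| WOp of arith_op & wexp & wexp.

Inductive bexp :=
| NLe of nexp & nexp
| NEq of nexp & nexp
| WLe of wexp & wexp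
| BNot of bexp
| BAnd of bexp & bexp.

Inductive cmd :=
| Skip
| NSet of nat & nexp
| NPut of nat & nexp & nexp       (* array, position, value *)
| WSet of nat & wexp
| WPut of nat & nexp & wexp
| Seq of cmd & cmd
| If of bexp & cmd & cmd
| While of bexp & cmd.

Record state (R : Type) := State {
  nreg : nat -> nat;
  narr : nat -> nat -> nat;
  wreg : nat -> R;
  warr : nat -> nat -> R }.

(* Expressions cost one unit per constructor. *)
Fixpoint ncost (e : nexp) : nat :=
  match e with
  | NConst _ | NReg _ => 1
  | NGet _ i => (ncost i).+1
  | NOp _ e1 e2 => (ncost e1 + ncost e2).+1
  end.

Fixpoint wcost (e : wexp) : nat :=
  match e with
  | WReg _ => 1
  | WGet _ i => (ncost i).+1
  | WOp _ e1 e2 => (wcost e1 + wcost e2).+1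
  end.

Fixpoint bcost (b : bexp) : nat :=
  match b with
  | NLe e1 e2 | NEq e1 e2 => (ncost e1 + ncost e2).+1
  | WLe e1 e2 => (wcost e1 + wcost e2).+1
  | BNot b1 => (bcost b1).+1
  | BAnd b1 b2 => (bcost b1 + bcost b2).+1
  end.

Section Machine.
Variable R : realType.
Implicit Types s : state R.

Definition nop (o : arith_op) : nat -> nat -> nat :=
  match o with Add => addn | Sub => subn | Mul => muln end.

Definition wop (o : arith_op) (x y : R) : R :=
  match o with Add => x + y | Sub => x - y | Mul => x * y end.

Fixpoint neval s (e : nexp) : nat :=
  match e with
  | NConst k => k
  | NReg r => nreg s r
  | NGet a i => narr s a (neval s i)
  | NOp o e1 e2 => nop o (neval s e1) (neval s e2)
  end.

Fixpoint weval s (e : wexp) : R :=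
  match e with
  | WReg r => wreg s r
  | WGet a i => warr s a (neval s i)
  | WOp o e1 e2 => wop o (weval s e1) (weval s e2)
  end.

Fixpoint beval s (b : bexp) : bool :=
  match b with
  | NLe e1 e2 => (neval s e1 <= neval s e2)%N
  | NEq e1 e2 => neval s e1 == neval s e2
  | WLe e1 e2 => weval s e1 <= weval s e2
  | BNot b1 => ~~ beval s b1
  | BAnd b1 b2 => beval s b1 && beval s b2
  end.

Definition update (X : Type) (f : nat -> X) (i : nat) (v : X) : nat -> X :=
  fun j => if j == i then v else f j.

Definition set_nreg s r v :=
  State (update (nreg s) r v) (narr s) (wreg s) (warr s).
Definition set_narr s a i v :=
  State (nreg s) (update (narr s) a (update (narr s a) i v)) (wreg s) (warr s).
Definition set_wreg s r v :=
  State (nreg s) (narr s) (update (wreg s) r v) (warr s).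
Definition set_warr s a i v :=
  State (nreg s) (narr s) (wreg s) (update (warr s) a (update (warr s a) i v)).

(* [exec c s t s']: the command c started in s halts in s' after t elementary
   operations. *)
Inductive exec : cmd -> state R -> nat -> state R -> Prop :=
| ExecSkip s : exec Skip s 1 s
| ExecNSet s r e : exec (NSet r e) s (ncost e).+1 (set_nreg s r (neval s e))
| ExecNPut s a i e :
    exec (NPut a i e) s (ncost i + ncost e).+1
      (set_narr s a (neval s i) (neval s e))
| ExecWSet s r e : exec (WSet r e) s (wcost e).+1 (set_wreg s r (weval s e))
| ExecWPut s a i e :
    exec (WPut a i e) s (ncost i + wcost e).+1
      (set_warr s a (neval s i) (weval s e))
| ExecSeq c1 c2 s1 s2 s3 t1 t2 :
    exec c1 s1 t1 s2 -> exec c2 s2 t2 s3 -> exec (Seq c1 c2) s1 (t1 + t2) s3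
| ExecIfTrue b c1 c2 s s' t :
    beval s b -> exec c1 s t s' -> exec (If b c1 c2) s (bcost b + t) s'
| ExecIfFalse b c1 c2 s s' t :
    ~~ beval s b -> exec c2 s t s' -> exec (If b c1 c2) s (bcost b + t) s'
| ExecWhileFalse b c s : ~~ beval s b -> exec (While b c) s (bcost b) s
| ExecWhileTrue b c s1 s2 s3 t1 t2 :
    beval s1 b -> exec c s1 t1 s2 -> exec (While b c) s2 t2 s3 ->
    exec (While b c) s1 (bcost b + t1 + t2) s3.

Variable n : nat.

(* The neighbours of each vertex may be listed in any order. *)
Definition adjacency_lists (G : wgraph R n) (L : 'I_n -> seq 'I_n) : Prop :=
  forall x, uniq (L x) /\ L x =i adj G x.

(* Registers 0 and 1 hold n and the degree bound D. The adjacency lists are laid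
   out one after the other in integer array 1, with the weights of the
   corresponding edges at the same positions of weight array 0; the list of
   vertex x occupies the positions from (array 0)[x] up to and excluding
   (array 0)[x + 1]. All the remaining memory holds zeros. *)
Definition input_state (G : wgraph R n) (D : nat) (L : 'I_n -> seq 'I_n) :
    state R :=
  State
    (fun r => match r with 0%N => n | 1%N => D | _ => 0%N end)
    (fun a k =>
       match a with
       | 0%N => sumn (take k [seq size (L x) | x <- enum 'I_n])
       | 1%N => nth 0%N (flatten [seq [seq val y | y <- L x] | x <- enum 'I_n]) k
       | _ => 0%N
       end)
    (fun _ => 0)
    (fun a k =>
       match a with
       | 0%N => nth 0 (flatten [seq [seq wt G x y | y <- L x] | x <- enum 'I_n]) k
       | _ => 0
       end).

(* Tree nodes are numbers: p < n stands for the leaf p, and p >= n for an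
   internal node with children (array 2)[p] and (array 3)[p]. *)
Fixpoint stored_at s (p : nat) (T : htree 'I_n) : Prop :=
  match T with
  | HLeaf v => p = v
  | HNode T1 T2 =>
      [/\ (n <= p)%N, stored_at s (narr s 2 p) T1 & stored_at s (narr s 3 p) T2]
  end.

Definition output_tree s (T : htree 'I_n) : Prop := stored_at s (nreg s 0) T.

End Machine.

(* Main.v *)
(* A tree is split recursively. At each cluster S the lightest balanced edge is
   cut; it is at most as heavy as e_S, so the cut costs at most Lambda W(S), and
   the clusters of one level are disjoint, so a level costs at most Lambda W.
   Balance leaves at most H levels. Every cluster is connected, hence
   h_T >= d_G; on edges d_G = 1, which gives W <= OPT_free, and h_T is itself an
   ultrametric, which gives OPT_free <= OPT_card.

   The program roots the tree by breadth-first search, so that an edge is named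
   by its lower end i and parents precede children in the search order. It then
   works in rounds, each of which cuts all current components at once in O(n)
   time: one top-down sweep finds the root of every component, one bottom-up
   sweep the sizes of both sides of every edge, and one more the lightest
   balanced edge of every component. The hierarchy is finally assembled by
   undoing the cuts from the last to the first. *)
From mathcomp Require Import all_boot all_order all_algebra.
From mathcomp Require Import all_classical all_reals all_analysis.
From mathcomp Require Import zify.
Require Import Defs.

Set Implicit Arguments.
Unset Strict Implicit.
Unset Printing Implicit Defensive.
Import Order.TTheory GRing.Theory Num.Theory.
Local Open Scope ring_scope.

(** * Distances and hierarchies *)

(** When a cluster S is split at the edge ab, the cluster of a and b is S itself, so ab pays w_ab
    (|S| - 1); this is why lightness is measured against W(S) / (|S| - 1). The quantity |S| - 1
    shrinks by the factor 1 - 1/D per level and is at least 1 while an edge is left, so a cut after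
    m complete levels requires (D/(D-1))^m <= n - 1, that is, m < H. The cost bound and the count of
    rounds both use this condition in the integer form D^m <= (D-1)^m (n-1). The main gap lies
    between the recursion and the machine: the recursion treats one cluster at a time, whereas a
    round chooses all its cuts on the partition found at its beginning. Cuts in other components do
    not change a component ([root_local]), so the cuts of a round can be recorded as if made one by
    one, and the hierarchy is read off this sequence backwards. Components are never stored as sets:
    parents have smaller numbers than children, and a component is named by the number at which the
    climb from any of its nodes stops. *)

Lemma finite_argmin (R : realType) (T : finType) (P : T -> Prop) (F : T -> R) :
  (exists x, P x) -> exists2 x, P x & forall y, P y -> F x <= F y.
Proof.
case=> x0 /asboolP Px0.
have [x /asboolP Px minx] := @arg_minP _ _ _ x0 (fun x => `[< P x >]) F Px0.
by exists x => // y Py; apply: minx; apply/asboolP.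
Qed.

Section Distance.
Variables (R : realType) (n : nat) (G : wgraph R n).

Lemma dist_le_path x p : path (adj G) x p -> (size p < n)%N ->
  (dist G x (last x p) <= size p)%N.
Proof.
move=> xp szp; rewrite /dist leqNgt; apply/negP => /(before_find 0%N).
rewrite nth_iota // add0n => /negbT /existsPn /(_ (in_tuple p)).
by rewrite /= xp eqxx.
Qed.

Lemma dist_gt0 x y : x != y -> (0 < dist G x y)%N.
Proof.
move=> neq; rewrite lt0n; apply/eqP => d0.
have n0 : (0 < n)%N by exact: leq_ltn_trans (ltn_ord x).
have: (dist G x y < size (iota 0 n))%N by rewrite d0 size_iota.
rewrite -has_find => /(nth_find 0%N); rewrite -/(dist G x y) d0 nth_iota //.
by case/existsP => p; rewrite tuple0 /= (negbTE neq).
Qed.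

(** A walk inside S may be taken without repeated vertices, so it has at most |S| - 1 edges; this
    also keeps its length below n, the limit of the search in [dist]. *)
Lemma dist_connected_on (S : {set 'I_n}) x y : connected_on G S ->
  x \in S -> y \in S -> (dist G x y <= #|S|.-1)%N.
Proof.
move=> conS xS yS; have /connectP [p xp ->] := conS x y xS yS.
case/shortenP: xp => p' xp' uniqp' _.
have allS : {subset x :: p' <= S}.
  move=> z; rewrite inE => /predU1P [-> //|].
  move: xp'; move: {uniqp'} x xS => x xS.
  elim: p' x xS => // u p' IH x xS /= /andP [/and3P [_ uS _] up'].
  by rewrite inE => /predU1P [->|]; [|exact: IH uS up'].
have szS : (size p' < #|S|)%N.
  by rewrite -[(size p').+1]/(size (x :: p')) -(card_uniqP uniqp');
    apply/subset_leq_card/fintype.subsetP.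
have szn : (size p' < n)%N.
  by apply: leq_trans szS _; rewrite -[X in (_ <= X)%N](card_ord n) max_card.
apply: leq_trans (dist_le_path _ szn) _; last by rewrite -ltnS prednK //; exact: leq_trans szS.
by apply: sub_path xp' => u v /and3P [].
Qed.

Lemma is_tree_connected_on : is_tree G -> connected_on G [set: 'I_n]%SET.
Proof.
case=> con _ x y _ _; rewrite (eq_connect (e' := adj G)) // => u v.
by rewrite /induced /= !finset.in_setT.
Qed.

End Distance.

Section Clusters.
Variable n : nat.
Implicit Types (T : htree 'I_n) (x y z : 'I_n).

Lemma leaves_gt0 T : (0 < size (leaves T))%N.
Proof. by elim: T => //= T1 IH1 T2 IH2; rewrite size_cat addn_gt0 IH1. Qed.

Definition leaf_set T : {set 'I_n} := [set z in leaves T].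

Lemma leaf_set_node T1 T2 :
  leaf_set (HNode T1 T2) = leaf_set T1 :|: leaf_set T2.
Proof. by apply/setP => z; rewrite !inE /= mem_cat. Qed.

Lemma card_leaf_set T : uniq (leaves T) -> #|leaf_set T| = size (leaves T).
Proof. by move=> /card_uniqP <-; rewrite cardsE. Qed.

Lemma clusterC T x y : cluster T x y = cluster T y x.
Proof.
rewrite /cluster; have -> // : lca_subtree T x y = lca_subtree T y x.
elim: T => //= T1 -> T2 ->.
by rewrite ![(x \in _) && _]andbC.
Qed.

Lemma mem_cluster T x y : x \in leaves T -> y \in leaves T ->
  (x \in cluster T x y) && (y \in cluster T x y).
Proof.
rewrite /cluster !inE.
elim: T => //= [v -> -> //|T1 IH1 T2 IH2]; rewrite !mem_cat => xT yT.
case: ifP => [/andP[? ?]|_]; first exact: IH1.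
by case: ifP => [/andP[? ?]|_]; [exact: IH2|rewrite /= !mem_cat xT yT].
Qed.

Lemma card_cluster_gt0 T x y : x \in leaves T -> y \in leaves T ->
  (0 < #|cluster T x y|)%N.
Proof.
by move=> xT yT; apply/card_gt0P; exists x; case/andP: (mem_cluster xT yT).
Qed.

Lemma card_cluster_gt1 T x y : x \in leaves T -> y \in leaves T -> x != y ->
  (1 < #|cluster T x y|)%N.
Proof.
move=> xT yT neq; have /andP [xC yC] := mem_cluster xT yT.
by apply/card_gt1P; exists x, y.
Qed.

Lemma cluster_sub T x y : cluster T x y \subset leaf_set T.
Proof.
rewrite /cluster /leaf_set; apply/fintype.subsetP => z; rewrite !inE.
elim: T => //= T1 IH1 T2 IH2; rewrite mem_cat.
by case: ifP => _; [move/IH1->|case: ifP => _; [move/IH2->; rewrite orbT|rewrite /= mem_cat]].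
Qed.

Lemma cluster_left T1 T2 x y : x \in leaves T1 -> y \in leaves T1 ->
  cluster (HNode T1 T2) x y = cluster T1 x y.
Proof. by rewrite /cluster /= => -> ->. Qed.

Lemma uniq_cat_notin (A : eqType) (s1 s2 : seq A) (a : A) :
  uniq (s1 ++ s2) -> a \in s2 -> (a \in s1) = false.
Proof.
rewrite cat_uniq => /and3P [_ /hasPn dis _] as2.
by apply/negbTE; exact: dis.
Qed.

Lemma cluster_right T1 T2 x y : uniq (leaves (HNode T1 T2)) ->
  x \in leaves T2 -> y \in leaves T2 ->
  cluster (HNode T1 T2) x y = cluster T2 x y.
Proof.
by move=> u xT yT; rewrite /cluster /= xT yT (uniq_cat_notin u xT).
Qed.

Lemma cluster_cross T1 T2 x y : uniq (leaves (HNode T1 T2)) ->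
  x \in leaves T1 -> y \in leaves T2 ->
  cluster (HNode T1 T2) x y = leaf_set (HNode T1 T2).
Proof.
move=> u xT yT; rewrite /cluster /= (uniq_cat_notin u yT) andbF.
have -> // : (x \in leaves T2) = false.
by apply: (uniq_cat_notin (s1 := leaves T2) (s2 := leaves T1)); rewrite // uniq_catC.
Qed.

(** Unless all three leaves lie below the same child, z is separated from x or from y at the root,
    and the cluster of that pair consists of all leaves of T. *)
Lemma card_cluster_ultra T x y z : uniq (leaves T) ->
  x \in leaves T -> y \in leaves T -> z \in leaves T ->
  (#|cluster T x y| <= maxn #|cluster T x z| #|cluster T z y|)%N.
Proof.
elim: T x y z => [v|T1 IH1 T2 IH2] x y z u.
  by rewrite /cluster /= leq_maxl.
have top a b : (#|cluster (HNode T1 T2) a b| <= #|leaf_set (HNode T1 T2)|)%N.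
  by apply/subset_leq_card/cluster_sub.
have := u; rewrite /= cat_uniq => /and3P [u1 _ u2].
rewrite !mem_cat => /orP [xT|xT] /orP [yT|yT] /orP [zT|zT].
- by rewrite !cluster_left //; exact: IH1.
- by rewrite (cluster_cross u xT zT) leq_max top.
- by rewrite (cluster_cross u zT yT) leq_max top orbT.
- by rewrite (cluster_cross u xT zT) leq_max top.
- by rewrite [cluster _ x z]clusterC (cluster_cross u zT xT) leq_max top.
- by rewrite [cluster _ z y]clusterC (cluster_cross u yT zT) leq_max top orbT.
- by rewrite [cluster _ x z]clusterC (cluster_cross u zT xT) leq_max top.
- by rewrite !(cluster_right u) //; exact: IH2.
Qed.

Lemma mem_hierarchy T x : is_hierarchy T -> x \in leaves T.
Proof. by move=> /perm_mem ->; rewrite mem_enum. Qed.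

Lemma uniq_hierarchy T : is_hierarchy T -> uniq (leaves T).
Proof. by move=> /perm_uniq ->; exact: enum_uniq. Qed.

Lemma card_ultra_ultrametric (R : realType) T : is_hierarchy T ->
  is_ultrametric (@card_ultra R n T).
Proof.
move=> hT; have inT x := mem_hierarchy x hT.
have ge0 x y : 0 <= card_ultra R T x y.
  by rewrite /card_ultra; case: eqP => // _; rewrite subr_ge0 ler1n card_cluster_gt0.
have ultra x y z : card_ultra R T x y <= Num.max (card_ultra R T x z) (card_ultra R T z y).
  have [->|nxy] := eqVneq x y; first by rewrite {1}/card_ultra eqxx le_max ge0.
  have [<-|nxz] := eqVneq x z; first by rewrite le_max lexx orbT.
  have [<-|nzy] := eqVneq z y; first by rewrite le_max lexx.
  rewrite /card_ultra (negbTE nxy) (negbTE nxz) (negbTE nzy).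
  have := card_cluster_ultra (uniq_hierarchy hT) (inT x) (inT y) (inT z).
  by rewrite leq_max le_max !lerD2r !ler_nat.
split=> //; split=> //.
- move=> x y; split=> [|->]; last by rewrite /card_ultra eqxx.
  rewrite /card_ultra; case: eqVneq => // nxy /eqP.
  rewrite subr_eq0 pnatr_eq1 => /eqP c1.
  by have := card_cluster_gt1 (inT x) (inT y) nxy; rewrite c1.
- by move=> x y; rewrite /card_ultra eq_sym clusterC.
- move=> x y z; apply: le_trans (ultra x y z) _.
  by rewrite ge_max lerDl lerDr !ge0.
Qed.

End Clusters.

(** * Existence of the two optima and the inequalities between them *)

Section Optima.
Variables (R : realType) (n : nat) (G : wgraph R n).
Implicit Types (u : 'I_n -> 'I_n -> R) (T : htree 'I_n).

Lemma ler_ultra_cost u v : (forall x y, adj G x y -> u x y <= v x y) ->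
  ultra_cost G u <= ultra_cost G v.
Proof.
move=> le_uv; apply: ler_sum => p /andP [_ adjp].
by rewrite ler_wpM2l ?le_uv // ltW // wt_gt0.
Qed.

Lemma total_weight_le_ultra_cost u : dominates_dist G u ->
  total_weight G <= ultra_cost G u.
Proof.
move=> dom; apply: ler_sum => p /andP [lt adjp].
apply: ler_peMr; first by rewrite ltW // wt_gt0.
apply: le_trans (dom _ _); by rewrite ler1n dist_gt0 //; apply: contraTneq lt => ->; rewrite ltnn.
Qed.

(* Rounding down and capping at n - 1 keep an ultrametric above the integral
   metric d_G, so finitely many ultrametrics compete. *)
Lemma OPT_free_exists : (forall x y, (dist G x y <= n.-1)%N) ->
  exists m, is_OPT_free G m.
Proof.
move=> distn.
pose uf (f : {ffun 'I_n * 'I_n -> 'I_n}) (x y : 'I_n) : R := (nat_of_ord (f (x, y)))%:R.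
have round u : is_ultrametric u -> dominates_dist G u ->
    exists f, [/\ is_ultrametric (uf f), dominates_dist G (uf f)
                & ultra_cost G (uf f) <= ultra_cost G u].
  move=> [[ge0 eq0 sym tri] ultra] dom.
  have lt x y : (minn (Num.truncn (u x y)) n.-1 < n)%N.
    have n0 : (0 < n)%N by exact: leq_ltn_trans (ltn_ord x).
    by rewrite -[X in (_ < X)%N](prednK n0) ltnS geq_minr.
  exists [ffun p => Ordinal (lt p.1 p.2)].
  have ufE x y : uf [ffun p => Ordinal (lt p.1 p.2)] x y
                 = (minn (Num.truncn (u x y)) n.-1)%:R by rewrite /uf ffunE.
  have dom' x y : (dist G x y <= minn (Num.truncn (u x y)) n.-1)%N.
    by rewrite leq_min distn truncn_ge_nat // dom.
  have ultra' x y z : (minn (Num.truncn (u x y)) n.-1 <=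
     maxn (minn (Num.truncn (u x z)) n.-1) (minn (Num.truncn (u z y)) n.-1))%N.
    have := ultra x y z; rewrite le_max => /orP [] /le_truncn; lia.
  split.
  - split; last by move=> x y z; rewrite !ufE -natr_max ler_nat ultra'.
    split=> [x y|x y|x y|x y z]; rewrite !ufE ?ler0n //.
    (* Rounding cannot merge distinct vertices: the rounded value is still at least their distance,
       which is positive. *)
    + split=> [/eqP|->].
        rewrite pnatr_eq0 => /eqP m0; apply/eqP; apply: contraT => /(dist_gt0 G).
        by have := dom' x y; rewrite m0 leqn0 => /eqP ->.
      by have /eq0 -> := erefl y; rewrite truncn0 min0n.
    + by rewrite sym.
    + by rewrite -natrD ler_nat; have := ultra' x y z; lia.
  - by move=> x y; rewrite ufE ler_nat.
  - apply: ler_ultra_cost => x y _; rewrite ufE.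
    apply: le_trans (_ : (Num.truncn (u x y))%:R <= _); last by rewrite truncn_le.
    by rewrite ler_nat geq_minl.
pose good f := is_ultrametric (uf f) /\ dominates_dist G (uf f).
have [] := @finite_argmin R _ good (fun f => ultra_cost G (uf f)).
  (* The constant n off the diagonal exceeds all distances; rounding this ultrametric shows that
     some competitor exists. *)
  pose u0 (x y : 'I_n) : R := if x == y then 0 else n%:R.
  have u0ge x y : 0 <= u0 x y by rewrite /u0; case: ifP; rewrite ?ler0n.
  have u0max x y z : u0 x y <= Num.max (u0 x z) (u0 z y).
    rewrite {1}/u0; case: eqVneq => [_|nxy]; first by rewrite le_max u0ge.
    rewrite /u0 le_max; case: (eqVneq x z) => [<-|_]; last by rewrite lexx.
    by rewrite (negbTE nxy) lexx orbT.
  have [] := round u0.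
  - split=> //; split=> //.
    + move=> x y; rewrite /u0; split=> [|->]; last by rewrite eqxx.
      case: eqVneq => // _ /eqP; rewrite pnatr_eq0 => /eqP n0.
      by have := leq_ltn_trans (leq0n x) (ltn_ord x); rewrite [X in (_ < X)%N]n0.
    + by move=> x y; rewrite /u0 eq_sym.
    + by move=> x y z; apply: le_trans (u0max x y z) _; rewrite ge_max lerDl lerDr !u0ge.
  - move=> x y; rewrite /u0; case: eqVneq => [->|_].
      have n0 : (0 < n)%N by exact: leq_ltn_trans (ltn_ord y).
      by have := @dist_le_path _ _ G y [::] isT n0; rewrite /= leqn0 => /eqP ->.
    by rewrite ler_nat; apply: leq_trans (distn x y) (leq_pred n).
  - by move=> f [? ? _]; exists f.
move=> f [uf_ultra uf_dom] fmin; exists (ultra_cost G (uf f)); split; first by exists (uf f).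
move=> _ [u [u_ultra u_dom ->]]; have [g [? ? le_gu]] := round u u_ultra u_dom.
by apply: le_trans le_gu; apply: fmin.
Qed.

(** Hierarchies do not form a finite type, but the cost depends only on the table of cluster sizes,
    and there are finitely many such tables. *)
Lemma OPT_card_exists T0 : is_hierarchy T0 ->
  dominates_dist G (card_ultra R T0) -> exists m, is_OPT_card G m.
Proof.
move=> hT0 dom0.
have lt (T : htree 'I_n) x y : (#|cluster T x y| < n.+1)%N.
  by rewrite ltnS -[X in (_ <= X)%N](card_ord n) max_card.
pose enc T : {ffun 'I_n * 'I_n -> 'I_n.+1} := [ffun p => Ordinal (lt T p.1 p.2)].
pose uf (f : {ffun 'I_n * 'I_n -> 'I_n.+1}) (x y : 'I_n) : R :=
  if x == y then 0 else (nat_of_ord (f (x, y)))%:R - 1.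
have encE T : uf (enc T) = card_ultra R T.
  by apply: boolp.funext => x; apply: boolp.funext => y; rewrite /uf /card_ultra ffunE.
pose good f := exists T, [/\ is_hierarchy T, dominates_dist G (card_ultra R T) & f = enc T].
have [] := @finite_argmin R _ good (fun f => ultra_cost G (uf f)).
  by exists (enc T0), T0.
move=> _ [T [hT domT ->]] Tmin; exists (ultra_cost G (card_ultra R T)).
split; first by exists T.
by move=> _ [T' [hT' domT' ->]]; rewrite -!encE; apply: Tmin; exists T'.
Qed.

Lemma OPT_chain T0 : is_hierarchy T0 -> (forall x y, (dist G x y <= n.-1)%N) ->
  dominates_dist G (card_ultra R T0) ->
  exists mF mC, [/\ is_OPT_free G mF, is_OPT_card G mC,
    total_weight G <= mF & mF <= mC].
Proof.
move=> hT0 distn dom0.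
have [mF optF] := OPT_free_exists distn.
have [mC optC] := OPT_card_exists hT0 dom0.
exists mF, mC; split=> //.
  by have [[u [_ domu ->]] _] := optF; exact: total_weight_le_ultra_cost.
have [[T [hT domT ->]] _] := optC; apply: optF.2.
by exists (card_ultra R T); split=> //; exact: card_ultra_ultrametric.
Qed.

End Optima.

(** * Hierarchies obtained by balanced cuts *)

Section GoodTrees.
Variables (R : realType) (n : nat) (G : wgraph R n) (D : nat) (Lambda : R).
Implicit Types (T : htree 'I_n) (S A B : {set 'I_n}).

(** The assumed inequalities with denominators cleared. The first two become integer tests that the
    program can make; the left side of the third is what ab pays when S is split there. *)
Definition good_split S A B (a b : 'I_n) : Prop :=
  [/\ (D * #|A|.-1 <= D.-1 * #|S|.-1)%N, (D * #|B|.-1 <= D.-1 * #|S|.-1)%N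
    & wt G a b * (#|S|.-1)%:R <= Lambda * set_weight G S].

(** The existence of a crossing edge keeps every cluster connected; its uniqueness makes every
    internal node pay for a single edge. *)
Fixpoint good_tree T : Prop :=
  match T with
  | HLeaf _ => True
  | HNode T1 T2 =>
      [/\ good_tree T1, good_tree T2
        & exists a b, [/\ a \in leaf_set T1, b \in leaf_set T2, adj G a b,
            forall x y, x \in leaf_set T1 -> y \in leaf_set T2 ->
              adj G x y -> x = a /\ y = b
          & good_split (leaf_set T) (leaf_set T1) (leaf_set T2) a b]]
  end.

Lemma induced_sym S : symmetric (induced G S).
Proof. by move=> x y; rewrite /induced /= adj_sym andbCA. Qed.

Lemma induced_sub S S' : S \subset S' ->
  subrel (connect (induced G S)) (connect (induced G S')).
Proof.
move=> /fintype.subsetP sub; apply: connect_sub => u v /and3P [uS vS uv].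
by apply: connect1; rewrite /induced /= !sub.
Qed.

Lemma good_tree_connected T : good_tree T -> connected_on G (leaf_set T).
Proof.
elim: T => [v _ x y|T1 IH1 T2 IH2].
  by rewrite !inE => /eqP -> /eqP ->; exact: connect0.
case=> /IH1 con1 /IH2 con2 [a [b [aT bT ab _ _]]] x y.
rewrite !leaf_set_node.
set S := leaf_set T1 :|: leaf_set T2.
have {}con1 : forall u v, u \in leaf_set T1 -> v \in leaf_set T1 -> connect (induced G S) u v.
  by move=> u v uT vT; apply/induced_sub/con1/vT => //; exact: finset.subsetUl.
have {}con2 : forall u v, u \in leaf_set T2 -> v \in leaf_set T2 -> connect (induced G S) u v.
  by move=> u v uT vT; apply/induced_sub/con2/vT => //; exact: finset.subsetUr.
have conab : connect (induced G S) a b.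
  by apply: connect1; rewrite /induced /= !finset.in_setU aT bT ab orbT.
have conba : connect (induced G S) b a.
  by rewrite (sym_connect_sym (@induced_sym S)).
rewrite !finset.in_setU => /orP [xT|xT] /orP [yT|yT].
- exact: con1.
- by apply: connect_trans (con1 _ _ xT aT) (connect_trans conab (con2 _ _ bT yT)).
- by apply: connect_trans (con2 _ _ xT bT) (connect_trans conba (con1 _ _ aT yT)).
- exact: con2.
Qed.

Lemma card_ultra_dominates T : uniq (leaves T) -> good_tree T ->
  forall x y, x \in leaves T -> y \in leaves T ->
  (dist G x y <= #|cluster T x y|.-1)%N.
Proof.
elim: T => [v _ _ x y|T1 IH1 T2 IH2 u gT x y].
  rewrite !inE => /eqP -> /eqP ->.
  have n0 : (0 < n)%N by exact: leq_ltn_trans (ltn_ord v).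
  by apply: leq_trans (@dist_le_path _ _ G v [::] isT n0) _.
have con := good_tree_connected gT.
have top : cluster (HNode T1 T2) x y = leaf_set (HNode T1 T2) ->
    x \in leaves (HNode T1 T2) -> y \in leaves (HNode T1 T2) ->
    (dist G x y <= #|cluster (HNode T1 T2) x y|.-1)%N.
  by move=> -> xT yT; apply: dist_connected_on; rewrite ?inE.
have := u; rewrite /= cat_uniq => /and3P [u1 _ u2]; case: gT => g1 g2 _.
rewrite !mem_cat => /orP [xT|xT] /orP [yT|yT].
- by rewrite cluster_left // IH1.
- by apply: top; rewrite ?cluster_cross //= mem_cat ?xT ?yT ?orbT.
- by apply: top; rewrite 1?clusterC ?cluster_cross //= mem_cat ?xT ?yT ?orbT.
- by rewrite cluster_right // IH2.
Qed.

Section SplitSum.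
Variables (S1 S2 : {set 'I_n}) (a b : 'I_n).
Hypotheses (dis : [disjoint S1 & S2]) (aS : a \in S1) (bS : b \in S2).
Hypothesis (ab : adj G a b).
Hypothesis only : forall x y, x \in S1 -> y \in S2 -> adj G x y -> x = a /\ y = b.

Definition pair_sum S (F : 'I_n -> 'I_n -> R) : R :=
  \sum_(p : 'I_n * 'I_n | (p.1 < p.2)%N && induced G S p.1 p.2) F p.1 p.2.

(** Only ab joins the two sides, and each edge is listed with its smaller end first, whence the test
    [a < b]. The proof compares the summands pair by pair, according to the sides of the two
    ends. *)
Lemma pair_sum_split (F : 'I_n -> 'I_n -> R) : pair_sum (S1 :|: S2) F =
  pair_sum S1 F + pair_sum S2 F + (if (a < b)%N then F a b else F b a).
Proof.
pose e := if (a < b)%N then (a, b) else (b, a).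
have -> : (if (a < b)%N then F a b else F b a)
    = \sum_(p : 'I_n * 'I_n | p == e) F p.1 p.2.
  by rewrite big_pred1_eq /e; case: ifP.
rewrite /pair_sum big_mkcond [X in _ = X + _ + _]big_mkcond.
rewrite [X in _ = _ + X + _]big_mkcond [X in _ = _ + _ + X]big_mkcond -!big_split /=.
apply: eq_bigr => -[x y] _; rewrite /induced /= !finset.in_setU.
have D12 z : z \in S1 -> z \in S2 = false by move=> zS; exact: disjointFr dis zS.
have nab : a != b by apply: contraTneq bS => <-; rewrite D12.
have nab' : (a : nat) != b by [].
have edge x' y' : x' \in S1 -> y' \in S2 -> adj G x' y' = ((x' == a) && (y' == b)).
  move=> xS yS; apply/idP/andP => [/only [] // -> ->|[/eqP -> /eqP ->] //].
  by rewrite !eqxx.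
have xe u v : ((u, v) == e) =
    if (a < b)%N then (u == a) && (v == b) else (u == b) && (v == a).
  by rewrite /e; case: ifP; rewrite xpair_eqE.
have Fa z : z \in S2 -> (z == a) = false.
  by move=> zS; apply/eqP => E; move: zS; rewrite E D12.
have Fb z : z \in S1 -> (z == b) = false.
  by move=> zS; apply/eqP => E; move: zS; rewrite E => /D12; rewrite bS.
rewrite xe.
case x1 : (x \in S1); case y1 : (y \in S1).
- by rewrite !D12 // !Fb // ?andbF /= if_same !addr0.
- rewrite (D12 x) //=; case y2 : (y \in S2); rewrite /= ?andbF ?add0r.
    rewrite edge // [x == b]Fb //=.
    case: (altP (x =P a)) => [->|_] /=; last by rewrite ?andbF ?if_same.
    case: (altP (y =P b)) => [->|_] /=; last by rewrite ?andbF ?if_same.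
    by rewrite andbT; case: ifP.
  have -> : (y == b) = false by apply: contraFF y2 => /eqP ->.
  have -> : (y == a) = false by apply: contraFF y1 => /eqP ->.
  by rewrite !andbF if_same.
- rewrite (D12 y) //=; case x2 : (x \in S2); rewrite /= ?andbF ?add0r.
    rewrite adj_sym edge // [x == a]Fa // [y == b]Fb //.
    case: (altP (x =P b)) => [->|_] /=; last by rewrite ?andbF ?if_same.
    case: (altP (y =P a)) => [->|_] /=; last by rewrite ?andbF ?if_same.
    by rewrite andbT ltn_neqAle eq_sym nab' leqNgt /=; case: ltnP.
  have -> : (x == b) = false by apply: contraFF x2 => /eqP ->.
  have -> : (x == a) = false by apply: contraFF x1 => /eqP ->.
  by rewrite if_same.
- have -> : (x == a) = false by apply: contraFF x1 => /eqP ->.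
  have -> : (y == a) = false by apply: contraFF y1 => /eqP ->.
  by rewrite ?andbF if_same addr0 add0r.
Qed.

End SplitSum.

Lemma set_weightE S : set_weight G S = pair_sum S (wt G).
Proof. by []. Qed.

Lemma set_weight_ge0 S : 0 <= set_weight G S.
Proof. by apply: sumr_ge0 => p /andP [_ /and3P [_ _ /wt_gt0 /ltW]]. Qed.

(** Restricting the sum to edges among the leaves of T gives a cost that makes sense for subtrees
    and so allows induction. *)
Definition tree_cost T : R :=
  pair_sum (leaf_set T) (fun x y => wt G x y * (#|cluster T x y|%:R - 1)).

Lemma costDE T : is_hierarchy T -> costD G T = tree_cost T.
Proof.
move=> hT; apply: eq_bigl => p.
by rewrite /induced /= !finset.inE !mem_hierarchy.
Qed.

(** The last hypothesis says |S| - 1 < (D/(D-1))^k without fractions: k = 0 forces a single leaf,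
    and a balanced split passes it on to both children with k - 1. The split itself pays at most
    Lambda W(S), and the children together weigh at most W(S). *)
Lemma good_tree_cost k T : (2 <= D)%N -> 0 <= Lambda ->
  uniq (leaves T) -> good_tree T ->
  ((#|leaf_set T|.-1) * D.-1 ^ k < D ^ k)%N ->
  tree_cost T <= Lambda * k%:R * set_weight G (leaf_set T).
Proof.
move=> D2 L0; elim: T k => [v|T1 IH1 T2 IH2] k u gT small.
  rewrite /tree_cost /pair_sum big_pred0 ?mulr_ge0 ?set_weight_ge0 //.
  move=> p; rewrite /induced /= !finset.inE.
  case: eqP => [->|]; last by rewrite andbF.
  by case: eqP => [->|]; rewrite ?ltnn ?andbF.
have := u; rewrite /= cat_uniq => /and3P [u1 dis u2].
have dis' : [disjoint leaf_set T1 & leaf_set T2].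
  apply/pred0P => z /=; rewrite !finset.inE; apply/negP => /andP [z1 z2].
  by have := hasPn dis z z2; rewrite /= z1.
case: gT => g1 g2 [a [b [aT bT ab only [bal1 bal2 light]]]].
have Lpos : (0 < #|leaf_set (HNode T1 T2)|.-1)%N.
  rewrite card_leaf_set // -ltnS prednK ?leaves_gt0 //= size_cat.
  exact: leq_add (leaves_gt0 T1) (leaves_gt0 T2).
case: k small => [|k] small; first by move: small; rewrite !expn0 muln1 ltnS leqNgt Lpos.
have step (A : {set 'I_n}) : (D * #|A|.-1 <= D.-1 * #|leaf_set (HNode T1 T2)|.-1)%N ->
    (#|A|.-1 * D.-1 ^ k < D ^ k)%N.
  move=> bal; rewrite -(ltn_pmul2l (m := D)) ?(leq_trans _ D2) // -expnS.
  apply: leq_ltn_trans small; rewrite mulnA expnS mulnA.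
  by rewrite leq_mul2r [(_ * D.-1)%N]mulnC bal orbT.
have split := pair_sum_split dis' aT bT ab only.
have cost_split : tree_cost (HNode T1 T2) =
    tree_cost T1 + tree_cost T2 + wt G a b * (#|leaf_set (HNode T1 T2)|.-1)%:R.
  rewrite {1}/tree_cost leaf_set_node split; congr (_ + _ + _).
  - by apply: eq_bigr => p /andP [_ /and3P []]; rewrite !finset.inE => *; rewrite cluster_left.
  - by apply: eq_bigr => p /andP [_ /and3P []]; rewrite !finset.inE => *; rewrite cluster_right.
  - move: aT bT; rewrite !finset.inE => aT bT.
    rewrite [cluster _ b a]clusterC (wt_sym (y := a)) 1?adj_sym // if_same cluster_cross //.
    by rewrite -leaf_set_node -subn1 natrB // (leq_trans Lpos) // leq_pred.
have Wsplit : set_weight G (leaf_set T1) + set_weight G (leaf_set T2)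
    <= set_weight G (leaf_set (HNode T1 T2)).
  rewrite leaf_set_node !set_weightE split lerDl; case: ifP => _; first exact/ltW/wt_gt0.
  by apply/ltW/wt_gt0; rewrite adj_sym.
have le1 := IH1 k u1 g1 (step _ bal1).
have le2 := IH2 k u2 g2 (step _ bal2).
rewrite cost_split -natr1 mulrDr mulr1 mulrDl.
apply: lerD light; apply: le_trans (lerD le1 le2) _.
by rewrite -mulrDr ler_wpM2l // mulr_ge0.
Qed.

End GoodTrees.

(** Taking logarithms turns the premise into m <= log(n-1) / log(D/(D-1)), and an integer below a
    real is below its floor. The tree and the program see the logarithm only through this integer
    form. *)
Lemma depth_bound_nat (R : realType) (n D : nat) : (2 <= D)%N -> (2 <= n)%N ->
  exists h : nat, [/\ (depth_bound R n D)%:~R = h%:R :> R, (0 < h)%N &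
    forall m, (D ^ m <= D.-1 ^ m * n.-1)%N -> (m < h)%N].
Proof.
move=> D2 n2.
have q1 : 1 < (D%:R / (D%:R - 1) : R).
  have D1 : 0 < D%:R - 1 :> R by rewrite subr_gt0 ltr1n.
  by rewrite ltr_pdivlMr // mul1r ltrBlDr ltrDl ltr01.
have n1 : 1 <= n%:R - 1 :> R by rewrite lerBrDr -[1 + 1]/(2%:R) ler_nat.
have lq : 0 < ln (D%:R / (D%:R - 1) : R) by exact: ln_gt0.
have l0 : 0 <= ln (n%:R - 1 : R) / ln (D%:R / (D%:R - 1) : R).
  by rewrite divr_ge0 // ?ln_ge0 // ltW.
rewrite /depth_bound; case E : (Num.floor _) => [f|f]; last first.
  by move: l0; rewrite -floor_ge0 E.
exists f.+1; split=> // m le_m.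
have : (m%:Z <= Num.floor (ln (n%:R - 1 : R) / ln (D%:R / (D%:R - 1) : R))).
  have D0 : (0 < D)%N by exact: leq_trans D2.
  have D1 : 0 < D%:R - 1 :> R by rewrite subr_gt0 ltr1n.
  rewrite floor_ge_int ler_pdivlMr // -[(m%:Z)%:~R]/(m%:R : R) [_ * ln _]mulr_natl.
  rewrite -lnXn; last exact: lt_trans q1.
  rewrite ler_ln ?posrE ?exprn_gt0 ?(lt_trans ltr01 q1) //; last exact: lt_le_trans n1.
  rewrite expr_div_n ler_pdivrMr ?exprn_gt0 // mulrC.
  by move: le_m; rewrite -!subn1 -(ler_nat R) natrM !natrX !natrB // ltnW.
by rewrite E lez_nat.
Qed.

(** * Components of a rooted tree after cutting edges *)

Record parent_map := ParentMap {
  parent :> nat -> nat;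
  parent_lt : forall i, (0 < i)%N -> (parent i < i)%N }.
Arguments parent_lt {p i} _ : rename.

Section Roots.
Variable par : parent_map.
Implicit Types (X Y : pred nat).

(* X lists the nodes whose edge to their parent is cut, so root X i is the top
   of the component of i. The fuel makes climb structural. *)
Fixpoint climb (fuel : nat) X i : nat :=
  if fuel is f.+1 then if (i == 0)%N || X i then i else climb f X (par i) else i.

Definition root X i := climb i.+1 X i.

Lemma climb_fuel X f i : (i < f)%N -> climb f X i = root X i.
Proof.
rewrite /root; elim/ltn_ind: i f => i IH [//|f]; rewrite ltnS => lif /=.
case: ifP => // /norP [i0 _].
have pi : (par i < i)%N by rewrite parent_lt // lt0n.
by rewrite (IH _ pi f) ?(IH _ pi i) // (leq_trans pi).
Qed.

Lemma rootE X i : root X i = if (i == 0)%N || X i then i else root X (par i).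
Proof.
rewrite {1}/root /=; case: ifP => // /norP [i0 _].
by rewrite climb_fuel // parent_lt // lt0n.
Qed.

Lemma root_stop X i : (i == 0)%N || X i -> root X i = i.
Proof. by rewrite rootE => ->. Qed.

Lemma root_par X i : (0 < i)%N -> ~~ X i -> root X i = root X (par i).
Proof. by rewrite lt0n => /negbTE i0 /negbTE Xi; rewrite rootE i0 Xi. Qed.

Lemma root_ind X (P : nat -> Prop) :
  (forall i, (i == 0)%N || X i -> P i) ->
  (forall i, (0 < i)%N -> ~~ X i -> P (par i) -> P i) -> forall i, P i.
Proof.
move=> P0 PS; elim/ltn_ind => i IH.
case stop : ((i == 0)%N || X i); first exact: P0.
by move/negbT: stop => /norP [i0 Xi]; apply: PS; rewrite ?lt0n //; apply/IH/parent_lt; rewrite lt0n.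
Qed.

Lemma eq_root X Y : X =1 Y -> root X =1 root Y.
Proof.
move=> XY i; elim/(@root_ind X): i => [i st|i i0 Xi IH].
  by rewrite !root_stop // -XY.
by rewrite (root_par i0 Xi) (root_par (X := Y) i0) // -XY.
Qed.

Lemma root_le X i : (root X i <= i)%N.
Proof.
elim/(@root_ind X): i => [i st|i i0 Xi IH]; first by rewrite root_stop.
by rewrite root_par // (leq_trans IH) // ltnW // parent_lt.
Qed.

Lemma root_root_stop X i : (root X i == 0)%N || X (root X i).
Proof.
elim/(@root_ind X): i => [i st|i i0 Xi IH]; first by rewrite root_stop.
by rewrite root_par.
Qed.

(** With more cuts the climb merely stops earlier on the same path. *)
Lemma root_sub X Y : (forall i, X i -> Y i) -> forall i, root X (root Y i) = root X i.
Proof.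
move=> XY i; elim/(@root_ind Y): i => [i st|i i0 Yi IH]; first by rewrite [root Y i]root_stop.
by rewrite [root Y i]root_par // IH [RHS]root_par //; apply: contra Yi; exact: XY.
Qed.

Lemma root_idem X i : root X (root X i) = root X i.
Proof. exact: root_sub. Qed.

Definition cut X b : pred nat := fun i => (i == b) || X i.

Lemma root_cut_lt X b : (0 < b)%N -> ~~ X b -> (root X b < b)%N.
Proof.
by move=> b0 Xb; rewrite root_par //; apply: leq_ltn_trans (root_le _ _) (parent_lt b0).
Qed.

Lemma root_cutb X b : root (cut X b) b = b.
Proof. by rewrite root_stop // /cut eqxx orbT. Qed.

(** A new cut at b concerns only the climbs through b: they now stop there, where they used to go on
    to [root X b]. *)
Lemma root_cut X b i : (0 < b)%N -> ~~ X b ->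
  root X i = if root (cut X b) i == b then root X b else root (cut X b) i.
Proof.
move=> b0 Xb; elim/(@root_ind (cut X b)): i => [i st|i i0].
  rewrite [root (cut X b) i]root_stop //; case: eqVneq => [-> //|ib].
  by rewrite root_stop //; move: st; rewrite /cut (negbTE ib).
by rewrite /cut => ni IH; have /norP [ib Xi] := ni;
  rewrite root_par // IH [root (cut X b) i]root_par.
Qed.

Lemma root_cut_root X b i : root (cut X b) (root X i) = root X i.
Proof.
by rewrite root_stop //; have := root_root_stop X i; rewrite /cut => /orP [->|->]; rewrite ?orbT.
Qed.

(** Cuts added in other components leave the component of r as it is. This makes the simultaneous
    cuts of a round independent of each other. *)
Lemma root_local X Y r : (forall i, X i -> Y i) -> root X r = r ->
  (forall i, Y i -> X i \/ root X i != r) ->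
  forall i, (root Y i == r) = (root X i == r).
Proof.
move=> XY rr new i; elim/(@root_ind Y): i => [i st|i i0 Yi IH].
  rewrite [root Y i]root_stop //.
  case/orP: st => [/eqP ->|Yi]; first by rewrite root_stop.
  case: (new i Yi) => [Xi|ne]; first by rewrite root_stop // Xi orbT.
  by rewrite (negbTE ne); apply: contraNF ne => /eqP ->; rewrite rr.
by rewrite root_par // IH [in RHS]root_par //; apply: contra Yi; exact: XY.
Qed.

End Roots.

Arguments root_stop {par X i} _.
Arguments root_par {par X i} _ _.
Arguments eq_root {par X Y} _ _.
Arguments root_le {par} X i.
Arguments root_root_stop {par} X i.
Arguments root_sub {par X Y} _ i.
Arguments root_idem {par} X i.
Arguments root_cut_lt {par X b} _ _.
Arguments root_cutb {par} X b.
Arguments root_cut {par X b} i _ _.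
Arguments root_cut_root {par} X b i.
Arguments root_local {par X Y r} _ _ _ i.

(** Positions are plain numbers, as in the machine, so [vtx] is total with arbitrary values from n
    on. By [adj_par] the graph has no edges besides the links to parents. *)
Record rooting (R : realType) (n : nat) (G : wgraph R n) := Rooting {
  par : parent_map;
  pos : 'I_n -> nat;
  vtx : nat -> 'I_n;
  pos_lt : forall v, (pos v < n)%N;
  posK : cancel pos vtx;
  vtxK : forall i, (i < n)%N -> pos (vtx i) = i;
  adj_par : forall u v, adj G u v =
    ((0 < pos u) && (pos v == par (pos u)))%N ||
    ((0 < pos v) && (pos u == par (pos v)))%N }.

(** * Components as vertex sets of the graph *)

Section Forest.
Variables (R : realType) (n : nat) (G : wgraph R n) (D : nat) (Lambda : R).
Variable F : rooting G.
Implicit Types (X Y : pred nat) (S : {set 'I_n}).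

Local Notation rt := (root (par F)).

Definition cl X r : {set 'I_n} := [set v | rt X (pos F v) == r].

Definition edge_wt i : R := wt G (vtx F i) (vtx F (par F i)).

(** Cutting above b splits its component into the part hanging from b, which gets the root b, and
    the rest, which keeps the old root. *)
Definition good_cut X b : Prop :=
  [/\ (0 < b < n)%N, ~~ X b &
      good_split G D Lambda (cl X (rt X b)) (cl (cut X b) b) (cl (cut X b) (rt X b))
        (vtx F b) (vtx F (par F b))].

Lemma in_cl X r v : (v \in cl X r) = (rt X (pos F v) == r).
Proof. by rewrite finset.inE. Qed.

Lemma par_ltn i : (i < n)%N -> (0 < i)%N -> (par F i < n)%N.
Proof. by move=> lin i0; apply: ltn_trans lin; exact: parent_lt. Qed.

Lemma adj_edge i : (0 < i < n)%N -> adj G (vtx F i) (vtx F (par F i)).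
Proof.
by case/andP=> i0 lin; rewrite (adj_par F) !vtxK ?par_ltn // i0 eqxx.
Qed.

(** If the lower end of the edge were cut, it would be the root of the component, and its parent, a
    smaller number, could not climb to it. *)
Lemma adj_cl X r u v : u \in cl X r -> v \in cl X r -> adj G u v ->
  exists i, [/\ (0 < i < n)%N, ~~ X i &
    (u = vtx F i /\ v = vtx F (par F i)) \/ (v = vtx F i /\ u = vtx F (par F i))].
Proof.
have half u' v' : rt X (pos F u') = rt X (pos F v') -> (0 < pos F u')%N ->
    pos F v' = par F (pos F u') ->
    [/\ (0 < pos F u' < n)%N, ~~ X (pos F u') 
      & u' = vtx F (pos F u') /\ v' = vtx F (par F (pos F u'))].
  move=> eqr u0 pv; split; rewrite ?u0 ?pos_lt // -?pv ?posK //.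
  apply/negP => Xu; move: eqr; rewrite root_stop ?Xu ?orbT // => eqr.
  have := root_le (par := par F) X (pos F v').
  by rewrite -eqr leqNgt pv parent_lt.
rewrite !in_cl (adj_par F) => /eqP ru /eqP rv /orP [] /andP [p0 /eqP pE].
  have [] := half u v _ p0 pE; first by rewrite ru rv.
  by move=> ? ? ?; exists (pos F u); split=> //; left.
have [] := half v u _ p0 pE; first by rewrite ru rv.
by move=> ? ? ?; exists (pos F v); split=> //; right.
Qed.

(** Used with Y = X to connect a component, and with one more cut in Y to connect each of its halves
    without the removed edge. *)
Lemma climb_connect (e : rel 'I_n) X r Y : (forall i, X i -> Y i) ->
  (forall i, (0 < i < n)%N -> ~~ Y i -> vtx F i \in cl X r ->
     vtx F (par F i) \in cl X r -> e (vtx F i) (vtx F (par F i))) ->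
  forall v, v \in cl X r -> connect e v (vtx F (rt Y (pos F v))).
Proof.
move=> XY eE v; rewrite -{1 2}(posK F v); move: (pos_lt F v).
move: (pos F v) => i; elim/(@root_ind (par F) Y): i => [i st _ _|i i0 Yi IH lin].
  by rewrite root_stop // connect0.
have pn := par_ltn lin i0.
rewrite in_cl vtxK // => ir.
have pr : rt X (par F i) == r.
  by rewrite -root_par //; apply: contra Yi; exact: XY.
rewrite [rt Y i]root_par //.
apply: connect_trans (IH pn _); last by rewrite in_cl vtxK.
by apply/connect1/eE; rewrite ?i0 ?in_cl ?vtxK.
Qed.

Lemma connected_cl X r : connected_on G (cl X r).
Proof.
have con v : v \in cl X r -> connect (induced G (cl X r)) v (vtx F r).
  move=> vr; have := vr; rewrite in_cl => /eqP {2}<-.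
  apply: (climb_connect (X := X) (r := r) (Y := X)) => // i lin _ ir pr.
  by rewrite /induced /= ir pr adj_edge.
move=> u v uS vS; apply: connect_trans (con u uS) _.
by rewrite (sym_connect_sym (@induced_sym _ _ _ _)) con.
Qed.

(** One inclusion holds because the new root is constant along the remaining edges, the other
    because climbing to it avoids the removed edge. *)
Lemma component_cut X i a : (0 < i < n)%N -> ~~ X i ->
  a \in cl X (rt X i) ->
  component (remove_edge (induced G (cl X (rt X i))) (vtx F i) (vtx F (par F i))) a
    = cl (cut X i) (rt (cut X i) (pos F a)).
Proof.
move=> lin Xi aS; set e := remove_edge _ _ _; have /andP [i0 iltn] := lin.
have pn := par_ltn iltn i0.
have e_sym : symmetric e.
  move=> u v; rewrite /e /remove_edge /= induced_sym !xpair_eqE.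
  by congr (_ && _); rewrite andbC [X in ~~ X && _ = _]andbC [X in _ && ~~ X = _]andbC.
have step u v : e u v -> rt (cut X i) (pos F u) = rt (cut X i) (pos F v).
  rewrite /e /remove_edge /induced /= => /andP [/and3P [uS vS uv] /andP []].
  have [k [/andP [k0 kn] Xk [[-> ->]|[-> ->]]]] := adj_cl uS vS uv.
    rewrite !vtxK ?par_ltn // => ne _; apply: root_par => //.
    by rewrite /cut negb_or Xk andbT; apply: contra ne => /eqP ->.
  rewrite !vtxK ?par_ltn // => _ ne; apply: esym; apply: root_par => //.
  by rewrite /cut negb_or Xk andbT; apply: contra ne => /eqP ->.
have conY v : v \in cl X (rt X i) -> connect e v (vtx F (rt (cut X i) (pos F v))).
  apply: climb_connect => [k|k kn]; first by rewrite /cut => ->; rewrite orbT.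
  rewrite /cut negb_or => /andP [ki Xk] kS pS; have /andP [k0 kltn] := kn.
  have kp := par_ltn kltn k0.
  have neq x y : (x < n)%N -> (y < n)%N -> (vtx F x == vtx F y) = (x == y).
    by move=> xn yn; apply/eqP/eqP => [/(congr1 (pos F))|->//]; rewrite !vtxK.
  rewrite /e /remove_edge /induced /= kS pS adj_edge // !xpair_eqE !neq //.
  (* The link above k could still be the removed edge read backwards; then i and k would be parents
     of each other. *)
  rewrite (negbTE ki) /=; apply/negP => /andP [/eqP E1 /eqP E2].
  by have := parent_lt (p := par F) i0; have := parent_lt (p := par F) k0;
    rewrite E2 -E1 ltnNge => /negbTE h /ltnW; rewrite h.
apply/setP => v; rewrite !finset.inE; apply/idP/eqP => [av|ev].
  have cl_e : fingraph.closed e [pred u | rt (cut X i) (pos F u) == rt (cut X i) (pos F a)].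
    by move=> x y exy; rewrite !inE (step _ _ exy).
  by apply/eqP; have := closed_connect cl_e av; rewrite !inE eqxx.
have vS : v \in cl X (rt X i).
  move: aS; rewrite !in_cl => /eqP <-; apply/eqP.
  by rewrite (root_cut (pos F v) i0 Xi) (root_cut (pos F a) i0 Xi) ev.
apply: connect_trans (conY a aS) _.
by rewrite (sym_connect_sym e_sym) -ev conY.
Qed.

End Forest.

(** * Balanced cuts: existence, independence, reversal, and sizes of parts *)

Section Cuts.
Variables (R : realType) (n : nat) (G : wgraph R n) (D : nat) (Lambda : R).
Variable F : rooting G.
Implicit Types (X Y : pred nat).

Local Notation rt := (root (par F)).

Lemma cl_self X v : v \in cl F X (rt X (pos F v)).
Proof. by rewrite in_cl. Qed.

Lemma cl_cut_split X b : (0 < b)%N -> ~~ X b ->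
  cl F X (rt X b) = cl F (cut X b) b :|: cl F (cut X b) (rt X b).
Proof.
move=> b0 Xb; apply/setP => v; rewrite finset.in_setU !in_cl.
by rewrite (root_cut (pos F v) b0 Xb); case: (eqVneq _ b); rewrite ?eqxx.
Qed.

Lemma cl_cut_disjoint X b : (0 < b)%N -> ~~ X b ->
  [disjoint cl F (cut X b) b & cl F (cut X b) (rt X b)].
Proof.
move=> b0 Xb; apply/pred0P => v /=; rewrite !in_cl.
apply/negP => /andP [/eqP -> /eqP E].
by have := root_cut_lt (par := par F) b0 Xb; rewrite -E ltnn.
Qed.

Lemma card_cl_cut X b : (0 < b)%N -> ~~ X b ->
  #|cl F X (rt X b)| = (#|cl F (cut X b) b| + #|cl F (cut X b) (rt X b)|)%N.
Proof.
move=> b0 Xb; rewrite cl_cut_split //; apply/eqP.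
by rewrite (leq_card_setU _ _).2 cl_cut_disjoint.
Qed.

Lemma cl_cut_other X b r : (0 < b)%N -> ~~ X b -> r != b -> r != rt X b ->
  cl F (cut X b) r = cl F X r.
Proof.
move=> b0 Xb rb rX; apply/setP => v; rewrite !in_cl (root_cut (pos F v) b0 Xb).
case: (eqVneq _ b) => [->|//]; by rewrite ![_ == r]eq_sym (negbTE rb) (negbTE rX).
Qed.

Lemma eq_cl X Y r : X =1 Y -> cl F X r = cl F Y r.
Proof. by move=> XY; apply/setP => v; rewrite !in_cl (eq_root XY). Qed.

Lemma cl_local X Y r : (forall i, X i -> Y i) -> rt X r = r ->
  (forall i, Y i -> X i \/ rt X i != r) -> cl F Y r = cl F X r.
Proof.
by move=> XY rr new; apply/setP => v; rewrite !in_cl (root_local XY rr new).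
Qed.

Lemma cl_all X r : (forall i, (0 < i < n)%N -> X i) -> (r < n)%N ->
  cl F X r = [set vtx F r].
Proof.
move=> all_cut rn; apply/setP => v; rewrite in_cl finset.inE root_stop.
  by apply/eqP/eqP => [<-|->]; rewrite ?posK ?vtxK.
by case: (posnP (pos F v)) => //= p0; rewrite all_cut // p0 pos_lt.
Qed.

Lemma cl_none : cl F pred0 0 = [set: 'I_n]%SET.
Proof.
apply/setP => v; rewrite in_cl finset.inE.
have := root_root_stop (par := par F) pred0 (pos F v).
by rewrite orbF.
Qed.

(** The size |S| - 1 <= (1 - 1/D)^m (n - 1) of the components after m rounds, without fractions. *)
Definition bound X m : Prop :=
  forall v, ((#|cl F X (rt X (pos F v))|.-1) * D ^ m <= D.-1 ^ m * n.-1)%N.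

Lemma bound0 X : bound X 0.
Proof.
move=> v; rewrite !expn0 muln1 mul1n -!subn1 leq_sub2r //.
by rewrite -[X in (_ <= X)%N](card_ord n) max_card.
Qed.

Lemma bound_uncut X m i : bound X m -> (0 < i < n)%N -> ~~ X i ->
  (D ^ m <= D.-1 ^ m * n.-1)%N.
Proof.
move=> bX /andP [i0 lin] Xi; apply: leq_trans (bX (vtx F i)).
have pn := par_ltn F lin i0.
apply: leq_pmull; rewrite -subn1 subn_gt0; apply/card_gt1P.
exists (vtx F i), (vtx F (par F i)); split; rewrite ?cl_self ?in_cl ?vtxK //.
  by rewrite [X in _ == X]root_par //.
apply/eqP => /(congr1 (pos F)); rewrite !vtxK // => E.
by have := parent_lt (p := par F) i0; rewrite -E ltnn.
Qed.

(** A component of Y lies in one half of the good cut made in the surrounding component of X; the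
    other cuts only shrink it further. *)
Lemma bound_round X Y m : (0 < D)%N -> (forall i, X i -> Y i) ->
  (forall r, (r < n)%N -> rt X r = r -> (1 < #|cl F X r|)%N ->
     exists b, [/\ good_cut D Lambda F X b, rt X b = r & Y b]) ->
  bound X m -> bound Y m.+1.
Proof.
move=> D0 XY cuts bX v; set r := rt X (pos F v).
have mono (Z : pred nat) : (forall i, Z i -> Y i) ->
    (#|cl F Y (rt Y (pos F v))| <= #|cl F Z (rt Z (pos F v))|)%N.
  move=> ZY; apply/subset_leq_card/fintype.subsetP => u; rewrite !in_cl => /eqP E.
  by rewrite -[rt Z (pos F u)](root_sub ZY) E (root_sub ZY).
have rlt : (r < n)%N by apply: leq_ltn_trans (root_le _ _) (pos_lt F v).
have rr : rt X r = r by rewrite root_idem //.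
have [card1|card1] := leqP #|cl F X r| 1.
  have := leq_trans (mono X XY) card1; rewrite -subn1 -subn_eq0 => /eqP ->.
  by rewrite mul0n.
have [b [[/andP [b0 bn] Xb [bal1 bal2 _]] br Yb]] := cuts r rlt rr card1.
have cutY i : cut X b i -> Y i by rewrite /cut => /orP [/eqP ->|/XY].
have bal : (D * (#|cl F Y (rt Y (pos F v))|.-1) <= D.-1 * #|cl F X r|.-1)%N.
  have le : (#|cl F Y (rt Y (pos F v))|.-1 <=
             #|cl F (cut X b) (rt (cut X b) (pos F v))|.-1)%N.
    by rewrite -!subn1 leq_sub2r // mono.
  apply: (@leq_trans (D * #|cl F (cut X b) (rt (cut X b) (pos F v))|.-1)%N).
    by rewrite leq_mul2l le orbT.
  have := root_cut (par := par F) (pos F v) b0 Xb; rewrite -/r.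
  case: eqP => [-> _|_ <-]; first by rewrite -br.
  by rewrite -br.
rewrite expnS mulnA [(_.-1 * D)%N]mulnC.
apply: leq_trans (_ : D.-1 * #|cl F X r|.-1 * D ^ m <= _)%N.
  by rewrite leq_mul2r bal orbT.
by rewrite expnS -!mulnA leq_mul2l bX orbT.
Qed.

(** The assumed edge e_S of the connected set S = [cl F X r], renamed by the position of its lower
    end. Either of a and b may be that end. *)
Lemma cut_exists X r : balanced_light_edges G D Lambda -> (2 <= D)%N ->
  (1 < #|cl F X r|)%N -> exists i, good_cut D Lambda F X i /\ rt X i = r.
Proof.
move=> bl D2 big.
have [a [b]] := bl _ (@connected_cl _ _ _ F X r) big.
set S := cl F X r; set A := component _ a; set B := component _ b.
case=> /and3P [aS bS ab] bal light.
have nat_bal (U : {set 'I_n}) : (0 < #|U|)%N ->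
    #|U|%:R - 1 <= (1 - D%:R^-1) * (#|S|%:R - 1) :> R -> (D * #|U|.-1 <= D.-1 * #|S|.-1)%N.
  move=> U0 le; have D0 : (0 : R) < D%:R by rewrite ltr0n (leq_trans _ D2).
  rewrite -(ler_nat R) !natrM -!subn1 !natrB ?(leq_trans _ D2) ?(leq_trans _ big) //.
  rewrite -(ler_pM2l D0) mulrA [_ * (1 - _)]mulrBr mulfV ?gt_eqF // mulr1 in le.
  exact: le.
have [i [lin Xi ends]] := adj_cl aS bS ab.
have /andP [i0 iltn] := lin; have pn := par_ltn F iltn i0.
have irE : rt X i = r.
  case: ends => [[aE _]|[bE _]].
    by move: aS; rewrite /S aE in_cl vtxK // => /eqP.
  by move: bS; rewrite /S bE in_cl vtxK // => /eqP.
(* The parent stays on the side of the old root: climbing never increases, so from a number below i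
   it cannot end at i. *)
have piE : rt (cut X i) (par F i) = r.
  have := root_cut (par := par F) (par F i) i0 Xi.
  rewrite -[LHS](root_par i0 Xi) irE; case: eqP => // E.
  have := root_le (par := par F) (cut X i) (par F i); rewrite E => h.
  by have := leq_trans (parent_lt (p := par F) i0) h; rewrite ltnn.
have iS : vtx F i \in cl F X (rt X i) by rewrite in_cl vtxK.
have pS : vtx F (par F i) \in cl F X (rt X i).
  by rewrite in_cl vtxK // [X in _ == X]root_par //.
have [compA compB] : A = cl F (cut X i) (rt (cut X i) (pos F a)) /\
    B = cl F (cut X i) (rt (cut X i) (pos F b)).
  rewrite /A /B /S; case: ends => [[aE bE]|[bE aE]]; rewrite aE bE -irE.
    by rewrite !component_cut.
  have swap u : component (remove_edge (induced G (cl F X (rt X i)))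
       (vtx F (par F i)) (vtx F i)) u
     = component (remove_edge (induced G (cl F X (rt X i)))
       (vtx F i) (vtx F (par F i))) u.
    apply/setP => w; rewrite !finset.inE; apply: eq_connect => x y.
    by rewrite /remove_edge /= [in LHS]andbA [in LHS]andbAC -andbA.
  by rewrite !swap !component_cut.
have pos0 u : (0 < #|cl F (cut X i) (rt (cut X i) (pos F u))|)%N.
  by apply/card_gt0P; exists u; exact: cl_self.
exists i; split=> //; split=> //; rewrite irE.
have S1 : 0 < #|S|%:R - 1 :> R by rewrite subr_gt0 ltr1n.
have lightS : wt G (vtx F i) (vtx F (par F i)) * (#|S|.-1)%:R <= Lambda * set_weight G S.
  have wE : wt G a b = wt G (vtx F i) (vtx F (par F i)).
    by case: ends => [[-> ->] //|[-> ->]]; rewrite wt_sym // adj_sym adj_edge.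
  by rewrite -subn1 natrB ?(leq_trans _ big) // -ler_pdivlMr // -mulrA -wE.
move: bal; rewrite ge_max => /andP [].
rewrite compA compB.
case: ends => [[aE bE]|[bE aE]]; rewrite aE bE !vtxK // root_cutb piE => balA balB;
  split=> //; apply: nat_bal => //.
- by have := pos0 (vtx F i); rewrite vtxK // root_cutb.
- by have := pos0 (vtx F (par F i)); rewrite vtxK // piE.
- by have := pos0 (vtx F i); rewrite vtxK // root_cutb.
- by have := pos0 (vtx F (par F i)); rewrite vtxK // piE.
Qed.

(** A cut chosen at the beginning of a round is still good when its turn comes, since the cuts made
    in between lie in other components. *)
Lemma good_cut_local X Y b : good_cut D Lambda F X b -> (forall i, X i -> Y i) ->
  (forall i, Y i -> X i \/ rt X i != rt X b) ->
  good_cut D Lambda F Y b /\ rt Y b = rt X b.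
Proof.
move=> [lin Xb split] XY new; have /andP [b0 bn] := lin.
have rr : rt X (rt X b) = rt X b by rewrite root_idem //.
have Yb : ~~ Y b by apply/negP => /new []; [apply/negP|rewrite eqxx].
have rE : rt Y b = rt X b by apply/eqP; rewrite (root_local XY rr new).
split=> //; split=> //; rewrite rE.
have cutXY i : cut X b i -> cut Y b i by rewrite /cut => /orP [->|/XY ->]; rewrite ?orbT.
have new' c : c = b \/ c = rt X b -> forall i, cut Y b i -> cut X b i \/ rt (cut X b) i != c.
  move=> cE i; rewrite /cut => /orP [->|/new [->|ne]]; [by left|by left; rewrite orbT|].
  right; apply: contra ne => /eqP E.
  by rewrite (root_cut i b0 Xb) E; case: cE => ->; rewrite ?eqxx // if_same.
rewrite (cl_local XY rr new) (cl_local cutXY _ (new' b _)) ?root_cutb //; last by left.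
by rewrite (cl_local cutXY _ (new' _ _)) ?root_cut_root //; right.
Qed.

Lemma good_tree_join X b T1 T2 : good_cut D Lambda F X b ->
  good_tree G D Lambda T1 -> good_tree G D Lambda T2 ->
  leaf_set T1 = cl F (cut X b) b -> leaf_set T2 = cl F (cut X b) (rt X b) ->
  good_tree G D Lambda (HNode T1 T2) /\ leaf_set (HNode T1 T2) = cl F X (rt X b).
Proof.
move=> [lin Xb split] g1 g2 e1 e2; have /andP [b0 bn] := lin.
have pn := par_ltn F bn b0.
have eS : leaf_set (HNode T1 T2) = cl F X (rt X b).
  by rewrite leaf_set_node e1 e2 -cl_cut_split.
split=> //=; split=> //; exists (vtx F b), (vtx F (par F b)).
rewrite -/(leaf_set (HNode T1 T2)) eS e1 e2; split=> //.
- by rewrite in_cl vtxK // root_cutb.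
- rewrite in_cl vtxK // [rt X b]root_par //.
  have := root_cut (par := par F) (par F b) b0 Xb; case: eqP => [E _|_ -> //].
  have := root_le (par := par F) (cut X b) (par F b); rewrite E => h.
  by have := leq_trans (parent_lt (p := par F) b0) h; rewrite ltnn.
- exact: adj_edge.
move=> x y; rewrite !in_cl => /eqP xb /eqP yr xy.
have ne : rt (cut X b) (pos F x) != rt (cut X b) (pos F y).
  by rewrite xb yr; apply/eqP => E; have := root_cut_lt (par := par F) b0 Xb; rewrite -E ltnn.
move: xy; rewrite (adj_par F) => /orP [] /andP [p0 /eqP pE].
  have cx : cut X b (pos F x).
    by apply: contraNT ne => cx; rewrite pE (root_par p0 cx).
  by rewrite -[x](posK F) -[y](posK F) pE -xb root_stop ?cx ?orbT.
(* The reverse orientation is impossible: y would be the old root, so y < b, while its parent x lies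
   in the part of b, so b <= x < y. *)
have cy : cut X b (pos F y).
  by apply: contraNT ne => cy; rewrite pE (root_par p0 cy).
have yE : pos F y = rt X b by rewrite -yr root_stop // cy orbT.
have := root_le (par := par F) (cut X b) (pos F x); rewrite xb pE => h.
have := leq_ltn_trans h (parent_lt (p := par F) p0); rewrite yE => h'.
by have := ltn_trans h' (root_cut_lt (par := par F) b0 Xb); rewrite ltnn.
Qed.

(* The bottom-up sweep, having treated the nodes above k, has added up the
   components of the tree in which all edges below the nodes up to k are cut. *)
Definition blocked X k : pred nat := fun j => (0 < j <= k)%N || X j.

(** All nodes of a component are at least its root, so cuts at numbers up to k do not divide the
    component rooted at k. *)
Lemma cl_blocked X k : rt X k = k -> cl F (blocked X k) k = cl F X k.
Proof.
move=> rk; apply: cl_local => // i; first by rewrite /blocked => ->; rewrite orbT.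
rewrite /blocked => /orP [/andP [i0 ik]|]; last by left.
have [//|Xi] := boolP (X i); [by left|right].
apply: contra Xi => /eqP E; have kE : i = k.
  by apply/eqP; rewrite eqn_leq ik -E root_le //.
by have := root_root_stop (par := par F) X i; rewrite E -kE (gtn_eqF i0).
Qed.

Lemma cl_blocked_cut X k : (0 < k)%N -> cl F (blocked X k) k = cl F (cut X k) k.
Proof.
move=> k0; rewrite -[RHS]cl_blocked ?root_cutb //; apply: eq_cl => i.
by rewrite /blocked /cut; case: eqVneq => // ->; rewrite k0 leqnn.
Qed.

(** One step of the size sweep: unblocking i merges its part into that of its parent, which is
    itself 0 or blocked and thus a root. *)
Lemma card_blocked_step X i k : (0 < i)%N -> (k < i)%N ->
  #|cl F (blocked X i.-1) k| =
  (#|cl F (blocked X i) k| +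
    if ~~ X i && (par F i == k) then #|cl F (blocked X i) i| else 0)%N.
Proof.
move=> i0 ki; have [Xi|Xi] /= := boolP (X i).
  rewrite addn0; congr #|pred_of_set _|; apply: eq_cl => j.
  rewrite /blocked; case: (eqVneq j i) => [->|ne]; first by rewrite Xi !orbT.
  by congr (_ || _); lia.
have bi : ~~ blocked X i.-1 i by rewrite /blocked negb_or Xi andbT; lia.
have cutE : cut (blocked X i.-1) i =1 blocked X i.
  move=> j; rewrite /blocked /cut; case: (eqVneq j i) => [->|ne]; first by rewrite i0 leqnn.
  by congr (_ || _); lia.
have rE : rt (blocked X i.-1) i = par F i.
  rewrite root_par //.
  apply: root_stop; rewrite /blocked; have := parent_lt (p := par F) i0.
  by case: (posnP (par F i)) => //= p0 pi; apply/orP; left; lia.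
have [<-|ne] := eqVneq (par F i) k.
  by rewrite -rE (card_cl_cut i0 bi) addnC !(eq_cl _ cutE).
rewrite addn0 -(eq_cl _ cutE) cl_cut_other //; first by rewrite ltn_eqF.
by rewrite rE eq_sym.
Qed.

End Cuts.

(** * Program logic *)

Section MachineRules.
Variable R : realType.
Implicit Types (s : state R) (c : cmd).

(** Carries the time bound over from the run that is constructed to an arbitrary run on the same
    input. *)
Lemma exec_det c s t1 s1 : exec c s t1 s1 ->
  forall t2 s2, exec c s t2 s2 -> t1 = t2 /\ s1 = s2.
Proof.
have absurd b s0 : beval s0 b -> ~~ beval s0 b -> False by move=> ->.
elim=> {c s t1 s1} [s|s r e|s a i e|s r e|s a i e|c1 c2 s1 s2 s3 t1 t2 _ IH1 _ IH2
  |b c1 c2 s s' t bs _ IH|b c1 c2 s s' t bs _ IH|b c s bs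
  |b c s1 s2 s3 t1 t2 bs _ IH1 _ IH2] t0 s0 H; inversion H; subst => //;
  try (by exfalso; eapply absurd; eauto);
  repeat match goal with
  | IH : forall t s, exec ?c ?x t s -> _ , E : exec ?c ?x _ _ |- _ =>
      destruct (IH _ _ E); subst; clear IH E
  end => //.
Qed.

Fixpoint loop_free c : bool :=
  match c with
  | Seq c1 c2 | If _ c1 c2 => loop_free c1 && loop_free c2
  | While _ _ => false
  | _ => true
  end.

(** Loop bodies are loop-free, so their effect is found by computation instead of by derivations of
    [exec]. The value at [While] is a dummy. *)
Fixpoint run c s : state R :=
  match c with
  | Skip | While _ _ => s
  | NSet r e => set_nreg s r (neval s e)
  | NPut a i e => set_narr s a (neval s i) (neval s e)
  | WSet r e => set_wreg s r (weval s e)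
  | WPut a i e => set_warr s a (neval s i) (weval s e)
  | Seq c1 c2 => run c2 (run c1 s)
  | If b c1 c2 => if beval s b then run c1 s else run c2 s
  end.

Fixpoint max_cost c : nat :=
  match c with
  | Skip => 1
  | NSet _ e => (ncost e).+1
  | NPut _ i e => (ncost i + ncost e).+1
  | WSet _ e => (wcost e).+1
  | WPut _ i e => (ncost i + wcost e).+1
  | Seq c1 c2 => max_cost c1 + max_cost c2
  | If b c1 c2 => bcost b + (max_cost c1 + max_cost c2)
  | While _ _ => 0
  end.

Lemma run_exec c s : loop_free c -> exists2 t, exec c s t (run c s) & (t <= max_cost c)%N.
Proof.
elim: c s => //=.
- by move=> s _; exists 1%N; [constructor|].
- by move=> r e s _; exists (ncost e).+1; [constructor|].
- by move=> a i e s _; exists (ncost i + ncost e).+1; [constructor|].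
- by move=> r e s _; exists (wcost e).+1; [constructor|].
- by move=> a i e s _; exists (ncost i + wcost e).+1; [constructor|].
- move=> c1 IH1 c2 IH2 s /andP [l1 l2].
  have [t1 e1 le1] := IH1 s l1; have [t2 e2 le2] := IH2 (run c1 s) l2.
  by exists (t1 + t2)%N; [exact: ExecSeq e1 e2|exact: leq_add].
- move=> b c1 IH1 c2 IH2 s /andP [l1 l2].
  case bs : (beval s b).
    have [t e le] := IH1 s l1; exists (bcost b + t)%N; first exact: ExecIfTrue.
    by rewrite leq_add2l (leq_trans le) // leq_addr.
  have [t e le] := IH2 s l2; exists (bcost b + t)%N.
    by apply: ExecIfFalse => //; rewrite bs.
  by rewrite leq_add2l (leq_trans le) // leq_addl.
Qed.

(* In I k t s, the number k counts the iterations and t the time they took. *)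
Lemma while_rule b c N (I : nat -> nat -> state R -> Prop) :
  (forall k t s, I k t s -> beval s b ->
     (k < N)%N /\ exists t' s', exec c s t' s' /\ I k.+1 (t + bcost b + t')%N s') ->
  forall s, I 0 0 s -> exists k t s',
    [/\ exec (While b c) s (t + bcost b) s', I k t s' & ~~ beval s' b].
Proof.
move=> step s I0.
suff main m k t s0 : (N - k <= m)%N -> I k t s0 -> exists k' t' s',
    [/\ exec (While b c) s0 (t' + bcost b) s', I k' (t + t')%N s' & ~~ beval s' b].
  by have [k [t [s' [e Ik nb]]]] := main N 0 0 s (leq_subr _ _) I0; exists k, t, s'.
elim: m k t s0 => [|m IH] k t s0 le Ik; case bs : (beval s0 b).
- by have [] := step _ _ _ Ik bs; move: le; rewrite leqn0 subn_eq0 leqNgt => /negbTE ->.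
- by exists k, 0, s0; rewrite addn0; split=> //; [apply: ExecWhileFalse|]; rewrite bs.
- have [kN [t' [s1 [e1 I1]]]] := step _ _ _ Ik bs.
  have [|k' [t2 [s' [e2 I2 nb]]]] := IH _ _ _ _ I1; first by lia.
  exists k', (bcost b + t' + t2)%N, s'; split=> //.
    by rewrite -addnA; exact: ExecWhileTrue bs e1 e2.
  by move: I2; rewrite !addnA.
- by exists k, 0, s0; rewrite addn0; split=> //; [apply: ExecWhileFalse|]; rewrite bs.
Qed.

(** The factor [N.+1] accounts for the final, failing test. *)
Lemma loop_rule b c N (I : nat -> state R -> Prop) : loop_free c ->
  (forall k s, I k s -> beval s b -> (k < N)%N /\ I k.+1 (run c s)) ->
  forall s, I 0 s -> exists k t s',
    [/\ exec (While b c) s t s', I k s', ~~ beval s' b &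
        (t <= N.+1 * (bcost b + max_cost c))%N].
Proof.
move=> lf step s I0.
pose J k t s := [/\ I k s, (t <= k * (bcost b + max_cost c))%N & (k <= N)%N].
have [||k [t [s' [e [Ik le kN] nb]]]] := @while_rule b c N J _ s.
- move=> k t s0 [Ik le kN] bs; have [kN' I1] := step _ _ Ik bs; split=> //.
  have [t' e le'] := run_exec s0 lf; exists t', (run c s0); split=> //; split=> //.
  by rewrite mulSn addnC addnA [(t' + t)%N]addnC; lia.
- by split.
- exists k, (t + bcost b)%N, s'; split=> //.
  rewrite mulSn addnC leq_add ?leq_addr // (leq_trans le) //.
  by rewrite leq_mul2r kN orbT.
Qed.

End MachineRules.

(* The program *)
Declare Scope prog_scope.
Delimit Scope prog_scope with prog.
Notation "x + y" := (NOp Add x y) : prog_scope.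
Notation "x - y" := (NOp Sub x y) : prog_scope.
Notation "x * y" := (NOp Mul x y) : prog_scope.
Notation "x < y" := (NLe (NOp Add x (NConst 1)) y) : prog_scope.
Notation "c1 ;; c2" := (Seq c1 c2) (at level 90, right associativity) : prog_scope.

Notation rN := (NReg 0).
Notation rD := (NReg 1).
Notation rI := (NReg 2).
Notation rJ := (NReg 3).
Notation rSeen := (NReg 4).
Notation rEnd := (NReg 5).
Notation rCuts := (NReg 6).

Local Open Scope prog_scope.

(* Nodes are positions in the search order. Integer arrays: 4 vertex, 5 parent,
   6 visited marks (by vertex), 7 cut marks, 8 root of the component, 9 size,
   10 selected edge of a component (0 if none), 11 and 12 cut edge and its root
   in order of cutting, 13 current tree of a component. Weight array 1: weight
   of the edge to the parent. *)
Definition bfs_visit : cmd :=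
  If (NEq (NGet 6 (NGet 1 rJ)) (NConst 0))
    (NPut 6 (NGet 1 rJ) (NConst 1) ;;
     NPut 4 rSeen (NGet 1 rJ) ;;
     NPut 5 rSeen rI ;;
     WPut 1 rSeen (WGet 0 rJ) ;;
     NSet 4 (rSeen + NConst 1))
    Skip ;;
  NSet 3 (rJ + NConst 1).

Definition bfs_start : cmd :=
  NSet 3 (NGet 0 (NGet 4 rI)) ;; NSet 5 (NGet 0 (NGet 4 rI + NConst 1)).

Definition bfs_scan : cmd :=
  bfs_start ;; While (rJ < rEnd) bfs_visit ;; NSet 2 (rI + NConst 1).

Definition bfs : cmd :=
  (NPut 6 (NConst 0) (NConst 1) ;; NSet 4 (NConst 1)) ;; While (rI < rSeen) bfs_scan.

Definition root_step : cmd :=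
  NPut 9 rI (NConst 1) ;; NPut 10 rI (NConst 0) ;;
  If (BAnd (BNot (NEq rI (NConst 0))) (NEq (NGet 7 rI) (NConst 0)))
    (NPut 8 rI (NGet 8 (NGet 5 rI)))
    (NPut 8 rI rI) ;;
  NSet 2 (rI + NConst 1).

(** The counter is lowered first, so a sweep that starts at n treats n - 1 down to 1, children
    before parents. *)
Definition size_step : cmd :=
  NSet 2 (rI - NConst 1) ;;
  If (NEq (NGet 7 rI) (NConst 0))
    (NPut 9 (NGet 5 rI) (NGet 9 (NGet 5 rI) + NGet 9 rI))
    Skip.

Notation size_of_root := (NGet 9 (NGet 8 rI)).
Notation best_of_root := (NGet 10 (NGet 8 rI)).

Notation is_balanced := (BAnd (NEq (NGet 7 rI) (NConst 0))
    (BAnd (NLe (rD * (NGet 9 rI - NConst 1))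
               ((rD - NConst 1) * (size_of_root - NConst 1)))
          (NLe (rD * ((size_of_root - NGet 9 rI) - NConst 1))
               ((rD - NConst 1) * (size_of_root - NConst 1))))).

(** The number 0 can stand for a missing candidate because the root names no edge. The second
    condition is the disjunction of no candidate yet and a candidate at least as heavy. *)
Definition select_step : cmd :=
  If (BAnd is_balanced
        (BNot (BAnd (BNot (NEq best_of_root (NConst 0)))
                    (BNot (WLe (WGet 1 rI) (WGet 1 best_of_root))))))
    (NPut 10 (NGet 8 rI) rI)
    Skip ;;
  NSet 2 (rI + NConst 1).

Definition cut_step : cmd :=
  If (NEq (NGet 10 rI) (NConst 0))
    Skip
    (NPut 7 (NGet 10 rI) (NConst 1) ;;
     NPut 11 rCuts (NGet 10 rI) ;;
     NPut 12 rCuts rI ;;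
     NSet 6 (rCuts + NConst 1)) ;;
  NSet 2 (rI + NConst 1).

Definition cut_round : cmd :=
  NSet 2 (NConst 0) ;; While (rI < rN) root_step ;;
  NSet 2 rN ;; While (NConst 1 < rI) size_step ;;
  NSet 2 (NConst 1) ;; While (rI < rN) select_step ;;
  NSet 2 (NConst 0) ;; While (rI < rN) cut_step.

Definition leaf_step : cmd :=
  NPut 13 rI (NGet 4 rI) ;; NSet 2 (rI + NConst 1).

(** Undoing a cut merges the part of the cut edge into the component that kept the old root, so the
    new tree is stored at that root. *)
Definition join_step : cmd :=
  NSet 6 (rCuts - NConst 1) ;;
  NPut 2 (rN + rCuts) (NGet 13 (NGet 11 rCuts)) ;;
  NPut 3 (rN + rCuts) (NGet 13 (NGet 12 rCuts)) ;;
  NPut 13 (NGet 12 rCuts) (rN + rCuts).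

Definition build_hierarchy : cmd :=
  While (rCuts + NConst 1 < rN) cut_round ;;
  NSet 2 (NConst 0) ;; While (rI < rN) leaf_step ;;
  While (NConst 0 < rCuts) join_step ;;
  NSet 0 (NGet 13 (NConst 0)).

Definition hierarchy_program : cmd := bfs ;; build_hierarchy.

Local Close Scope prog_scope.

(** * Correctness of a round *)

Section Round.
Variables (R : realType) (n : nat) (G : wgraph R n) (D : nat) (Lambda : R).
Variable F : rooting G.
Hypotheses (D2 : (2 <= D)%N) (n2 : (2 <= n)%N) (bl : balanced_light_edges G D Lambda).
Implicit Types (s : state R) (c : seq nat) (X : pred nat).

Local Notation rt := (root (par F)).

Definition is_cut c : pred nat := fun i => i \in c.

(* The cuts are listed from the latest to the earliest. *)
Fixpoint recorded (cs cr : nat -> nat) c : Prop :=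
  if c is b :: c' then
    [/\ cs (size c') = b, cr (size c') = rt (is_cut c') b,
        good_cut D Lambda F (is_cut c') b & recorded cs cr c']
  else True.

(** What the search leaves behind for the later loops, which only read it. *)
Definition static s : Prop :=
  [/\ nreg s 0 = n, nreg s 1 = D,
      forall i, (i < n)%N -> narr s 4 i = vtx F i,
      forall i, (i < n)%N -> narr s 5 i = par F i
    & forall i, (0 < i < n)%N -> warr s 1 i = edge_wt F i].

Definition cuts_in c s : Prop :=
  [/\ forall i, (i < n)%N -> (narr s 7 i == 0)%N = (i \notin c),
      nreg s 6 = size c & recorded (narr s 11) (narr s 12) c].

Lemma recorded_ext cs cr cs' cr' c :
  (forall k, (k < size c)%N -> cs' k = cs k /\ cr' k = cr k) ->
  recorded cs cr c -> recorded cs' cr' c.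
Proof.
elim: c => //= b c IH ext [e1 e2 gc rc].
have [e1' e2'] := ext (size c) (leqnn _); split=> //.
- by rewrite e1'.
- by rewrite e2'.
- by apply: IH rc => k kc; apply: ext; exact: leqW.
Qed.

Lemma recorded_uniq cs cr c : recorded cs cr c ->
  uniq c /\ {subset c <= iota 1 n.-1}.
Proof.
elim: c => //= b c IH [_ _ [/andP [b0 bn] bc _] /IH [-> sub]].
split; first by rewrite andbT.
move=> i; rewrite inE => /predU1P [->|/sub //].
by rewrite mem_iota b0 /= add1n prednK // (leq_trans _ n2).
Qed.

(** Pigeonhole: the cuts are distinct numbers among 1, ..., n - 1. *)
Lemma recorded_full cs cr c : recorded cs cr c -> (n <= (size c).+1)%N ->
  forall i, (0 < i < n)%N -> is_cut c i.
Proof.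
clear D2; move=> /recorded_uniq [uc sub] le i lin.
have [|_ eqi] := uniq_min_size uc sub.
  by rewrite size_iota -ltnS prednK // ltnW.
by rewrite /is_cut eqi mem_iota; lia.
Qed.

Lemma uncut_exists c : ((size c).+1 < n)%N -> exists2 i, (0 < i < n)%N & ~~ is_cut c i.
Proof.
clear D2; move=> lt; case E : (all (is_cut c) (iota 1 n.-1)); last first.
  move/negbT: E => /allPn [i]; rewrite mem_iota => lin ni.
  by exists i => //; lia.
have := uniq_leq_size (iota_uniq 1 n.-1) (allP E : {subset _ <= c}).
by rewrite size_iota -ltnS prednK ?(ltnW n2) // leqNgt lt.
Qed.

Definition balanced X i : bool :=
  [&& ~~ X i,
      (D * #|cl F (cut X i) i|.-1 <= D.-1 * #|cl F X (rt X i)|.-1)%N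
    & (D * #|cl F (cut X i) (rt X i)|.-1 <= D.-1 * #|cl F X (rt X i)|.-1)%N].

(** If r is not a root, no position climbs to it and b is 0; hence the cutting sweep may run over
    all numbers r without knowing the roots. *)
Definition best_below X m r (b : nat) : Prop :=
  if b == 0%N then forall i, (0 < i < m)%N -> balanced X i -> rt X i != r
  else [/\ (0 < b < m)%N, balanced X b, rt X b = r
    & forall i, (0 < i < m)%N -> balanced X i -> rt X i = r ->
        edge_wt F b <= edge_wt F i].

Lemma card_cl_rt_gt0 X i : (i < n)%N -> (0 < #|cl F X (rt X i)|)%N.
Proof. by move=> lin; apply/card_gt0P; exists (vtx F i); rewrite in_cl vtxK. Qed.

Lemma best_good X r b : best_below X n r b -> b != 0%N ->
  good_cut D Lambda F X b /\ rt X b = r.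
Proof.
rewrite /best_below => + b0; rewrite (negbTE b0).
case=> lin /and3P [Xb bal1 bal2] br wmin; split=> //; split=> //; split=> //.
have /andP [bpos bn] := lin.
have big : (1 < #|cl F X (rt X b)|)%N.
  rewrite card_cl_cut // -addn1 leq_add //.
    by have := card_cl_rt_gt0 (cut X b) bn; rewrite root_cutb.
  by have := card_cl_rt_gt0 (cut X b) (leq_ltn_trans (root_le (par := par F) X b) bn);
    rewrite root_cut_root.
have [i [[iin Xi [balA balB light]] ir]] := cut_exists bl D2 big.
rewrite ir in balA balB light.
apply: le_trans light; rewrite ler_wpM2r ?ler0n //.
by apply: wmin; rewrite // ?ir // /balanced Xi ir balA balB.
Qed.

(** In a larger component e_S would be a candidate, so a round leaves only singletons uncut. *)
Lemma best_none X r : best_below X n r 0 -> (#|cl F X r| <= 1)%N.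
Proof.
move=> none; rewrite leqNgt; apply/negP => big.
have [i [[iin Xi [balA balB _]] ir]] := cut_exists bl D2 big.
by have /negP := none i iin (introT and3P (And3 Xi balA balB)); rewrite ir; apply.
Qed.

Definition roots_in X s : Prop := forall i, (i < n)%N -> narr s 8 i = rt X i.

(** One formula with two meanings: at a root it is the whole component ([cl_blocked]), at any
    positive j it is the part that a cut above j would detach ([cl_blocked_cut]). *)
Definition sizes_in X s : Prop :=
  forall j, (j < n)%N -> narr s 9 j = #|cl F (blocked X j) j|.

Definition loop_cost (b : bexp) (c : cmd) : nat := (bcost b + max_cost c)%N.

Lemma root_loop c s : static s -> cuts_in c s -> nreg s 2 = 0%N ->
  exists t s', [/\ exec (While (rI < rN)%prog root_step) s t s',
    static s', cuts_in c s', roots_in (is_cut c) s' /\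
      (forall i, (i < n)%N -> narr s' 9 i = 1%N /\ narr s' 10 i = 0%N)
    & (t <= n.+1 * loop_cost (rI < rN)%prog root_step)%N].
Proof.
move=> st cu i0.
pose I k s := [/\ static s, cuts_in c s, nreg s 2 = k & (k <= n)%N /\
  forall i, (i < k)%N -> [/\ narr s 9 i = 1%N, narr s 10 i = 0%N & narr s 8 i = rt (is_cut c) i]].
have [||k [t [s' [e [st' cu' ik [kn inv]] nb le]]]] :=
    @loop_rule _ (rI < rN)%prog root_step n I isT _ s.
- move=> k s0 [st0 cu0 ik [kn inv]] /=.
  have [n0 _ _ parE _] := st0; have [cutE _ _] := cu0.
  rewrite n0 ik addn1 => lt; split=> //.
  have base : root (par F) (is_cut c) k = if (k == 0)%N || ~~ (narr s0 7 k == 0)%N then k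
      else narr s0 8 (narr s0 5 k).
    rewrite rootE cutE // negbK; case: ifP => // /norP [k0 _].
    have pk : (par F k < k)%N by rewrite parent_lt // lt0n.
    by rewrite parE //; have [_ _ ->] := inv _ pk.
  rewrite /I /= /update /=.
  case: ifP => test; (split; [exact: st0|exact: cu0|by rewrite /= ik addn1|]); split=> // i;
    rewrite ltnS /= /update /= leq_eqVlt; case: eqVneq => [-> _|ne /= /inv //]; rewrite ?eqxx.
  + split=> //; rewrite base; move: test; case: (k == 0)%N => //=; rewrite ?andbF // => ->.
    by [].
  + split=> //; rewrite base; move: test; case: (k == 0)%N => //= ->.
    by [].
- by split.
exists t, s'; split=> //; have kE : k = n.
  by move: nb st' => /= + [n0 _ _ _ _]; rewrite n0 ik addn1 -leqNgt => nk; apply/eqP;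
    rewrite eqn_leq kn.
by rewrite kE in inv; split=> i /inv [].
Qed.


Lemma size_loop c s : static s -> cuts_in c s -> nreg s 2 = n -> roots_in (is_cut c) s ->
  (forall i, (i < n)%N -> narr s 9 i = 1%N /\ narr s 10 i = 0%N) ->
  exists t s', [/\ exec (While (NConst 1 < rI)%prog size_step) s t s',
    static s' /\ cuts_in c s', roots_in (is_cut c) s' /\ sizes_in (is_cut c) s',
    forall i, (i < n)%N -> narr s' 10 i = 0%N
    & (t <= n.+1 * loop_cost (NConst 1 < rI)%prog size_step)%N].
Proof.
clear D2; move=> st cu i0 rts init.
(* After k iterations the positions below n - k are still blocked. The maximum with j appears
   because the size of j receives contributions only from positions above j and is final once these
   are done. *)
pose I k s := [/\ static s /\ cuts_in c s, nreg s 2 = (n - k)%N,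
  roots_in (is_cut c) s, forall i, (i < n)%N -> narr s 10 i = 0%N & (k < n)%N /\
  forall j, (j < n)%N -> narr s 9 j = #|cl F (blocked (is_cut c) (maxn (n - k).-1 j)) j|].
have [||k [t [s' [e [[st' cu'] ik rts' b0 [kn inv]] nb le]]]] :=
    @loop_rule _ (NConst 1 < rI)%prog size_step n I isT _ s.
- move=> k s0 [[st0 cu0] ik rts0 b0 [kn inv]].
  have [_ _ _ parE _] := st0; have [cutE _ _] := cu0.
  rewrite [beval _ _]/= ik => lt; split=> //.
  set i := (n - k.+1)%N.
  have iE : (n - k - 1)%N = i by rewrite /i; lia.
  have ki : (n - k).-1 = i by rewrite /i; lia.
  have ipos : (0 < i)%N by rewrite /i; lia.
  have iltn : (i < n)%N by rewrite /i; lia.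
  have kn' : (k.+1 < n)%N by rewrite -subn_gt0.
  have step j : (j < n)%N -> #|cl F (blocked (is_cut c) (maxn i.-1 j)) j| =
      (narr s0 9 j + if ~~ is_cut c i && (par F i == j) then narr s0 9 i else 0)%N.
    move=> jn; rewrite !inv // ki maxnn.
    have [ji|ij] := ltnP j i.
      by rewrite (_ : maxn i.-1 j = i.-1) ?card_blocked_step ?(maxn_idPl (ltnW ji)) //; lia.
    rewrite (_ : maxn i.-1 j = j) 1?(maxn_idPr ij); last by lia.
    have -> : (par F i == j) = false by have := parent_lt (p := par F) ipos; lia.
    by rewrite andbF addn0.
  rewrite /I /= /update /= ik iE cutE // parE //.
  case: ifP => test; split=> //; split=> // j jn;
    rewrite -/i step // /is_cut test /= /update /= ?addn0 //.
  by rewrite [j == _]eq_sym; case: eqVneq => [->|_]; rewrite ?addn0.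
- split; [by []|by rewrite subn0|by []|by move=> i /init []|].
  split=> [|j jn]; first exact: ltnW.
  rewrite subn0 (init j jn).1 cl_all ?cards1 // => i lin.
  by rewrite /blocked; apply/orP; left; lia.
exists t, s'; split=> //; split=> // j jn.
move: nb; rewrite [beval _ _]/= ik => nb.
by rewrite inv // (_ : maxn _ _ = j) //; lia.
Qed.

End Round.

(** * Selecting and making the cuts of a round *)

Section RoundSelect.
Variables (R : realType) (n : nat) (G : wgraph R n) (D : nat) (Lambda : R).
Variable F : rooting G.
Hypotheses (D2 : (2 <= D)%N) (n2 : (2 <= n)%N) (bl : balanced_light_edges G D Lambda).
Implicit Types (s : state R) (c : seq nat) (X : pred nat).

Local Notation rt := (root (par F)).
Local Notation static := (static D F).
Local Notation cuts_in := (cuts_in D Lambda F).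
Local Notation roots_in := (roots_in F).
Local Notation sizes_in := (sizes_in F).
Local Notation balanced := (balanced D F).
Local Notation best_below := (best_below D F).

Lemma best_extend X i r b : (0 < i)%N -> best_below X i r b ->
  (balanced X i -> rt X i = r -> b != 0%N /\ edge_wt F b <= edge_wt F i) ->
  best_below X i.+1 r b.
Proof.
move=> i0; rewrite /best_below; case: eqVneq => [_ none|b0 [lb bb br bmin]] new.
  move=> j /andP [j0]; rewrite ltnS leq_eqVlt => /predU1P [->|ji]; last by apply: none; rewrite j0.
  by move=> bali; apply/eqP => /(new bali) [].
split=> //; first by lia.
move=> j /andP [j0]; rewrite ltnS leq_eqVlt => /predU1P [->|ji]; last by apply: bmin; rewrite j0.
by move=> bali ri; have [] := new bali ri.
Qed.

Lemma best_new X i b : (0 < i)%N -> best_below X i (rt X i) b -> balanced X i ->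
  (b != 0%N -> edge_wt F i <= edge_wt F b) -> best_below X i.+1 (rt X i) i.
Proof.
move=> i0 old bali new; rewrite {1}/best_below (gtn_eqF i0); split=> //; first by rewrite i0 /=.
move=> j /andP [j0]; rewrite ltnS leq_eqVlt => /predU1P [-> //|ji] balj rj.
have j0i : (0 < j < i)%N by rewrite j0.
move: old new; rewrite /best_below; case: eqVneq => [_ none|b0 [_ _ _ bmin]] new.
  by have := none j j0i balj; rewrite rj eqxx.
by apply: le_trans (new isT) (bmin j j0i balj rj).
Qed.

Lemma select_loop c s : static s -> cuts_in c s -> nreg s 2 = 1%N ->
  roots_in (is_cut c) s -> sizes_in (is_cut c) s ->
  (forall i, (i < n)%N -> narr s 10 i = 0%N) ->
  exists t s', [/\ exec (While (rI < rN)%prog select_step) s t s',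
    static s', cuts_in c s',
    forall r, (r < n)%N -> best_below (is_cut c) n r (narr s' 10 r)
    & (t <= n.+1 * loop_cost (rI < rN)%prog select_step)%N].
Proof.
move=> st cu i0 rts szs b0; set X := is_cut c.
pose I k s := [/\ static s /\ cuts_in c s, nreg s 2 = k.+1 /\ (k < n)%N,
  roots_in X s, sizes_in X s
  & forall r, (r < n)%N -> best_below X k.+1 r (narr s 10 r)].
have [||k [t [s' [e [[st' cu'] [ik kn] _ _ best] nb le]]]] :=
    @loop_rule _ (rI < rN)%prog select_step n I isT _ s.
- move=> k s0 [[st0 cu0] [ik kn] rts0 szs0 best0].
  have [n0 D0 _ parE wE] := st0; have [cutE _ _] := cu0.
  rewrite [beval _ _]/= n0 ik addn1 => lt; split; first exact: ltnW.
  set i := k.+1 in ik lt best0 *.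
  have ipos : (0 < i)%N by [].
  have rlt : (rt X i < n)%N by apply: leq_ltn_trans (root_le _ _) lt.
  (* The size of the upper half is a difference, by [card_cl_cut]. *)
  have balE : beval s0 is_balanced = balanced X i.
    rewrite /= ik cutE // /balanced -/(is_cut c i) -/X.
    case Xi : (X i) => //=; move/negbT: Xi => Xi.
    rewrite D0 rts0 // !szs0 // cl_blocked_cut // cl_blocked ?root_idem //.
    by rewrite (card_cl_cut F ipos Xi) addKn !subn1.
  rewrite /I [run _ _]/= -/(beval s0 is_balanced) balE ik rts0 //.
  case: ifP => test; (split; [by []| by rewrite /= ik addn1|by []|by []|]) => r rn.
  + case/andP: test => bali test; rewrite /= /update /=.
    case: eqVneq => [->|ne].
      apply: (best_new ipos (best0 _ rlt) bali) => bn0.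
      move: test; rewrite (negbTE bn0) /= negbK; have := best0 _ rlt.
      rewrite {1}/best_below (negbTE bn0) => -[lb _ _ _].
      have bn : (0 < narr s0 10 (rt X i) < n)%N by lia.
      by rewrite !wE.
    apply: (best_extend ipos (best0 _ rn)) => _ ri.
    by rewrite ri eqxx in ne.
  + rewrite /= /update /=; apply: (best_extend ipos (best0 _ rn)) => bali ri.
    move: test; rewrite bali ri /= => /negbFE /andP [bn0 wlt]; split=> //.
    have := best0 _ rn; rewrite {1}/best_below (negbTE bn0) => -[lb _ _ _].
    have bn : (0 < narr s0 10 r < n)%N by lia.
    by move: wlt; rewrite !wE // -ltNge => /ltW.
- split=> //; first by rewrite ltnW.
  by move=> r rn; rewrite b0 // /best_below eqxx; case=> [|i] /andP [].
have kE : k.+1 = n.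
  by move: nb; rewrite [beval _ _]/= ik; case: st' => -> _ _ _ _; lia.
by rewrite kE in best; exists t, s'.
Qed.

Lemma cut_loop c s : static s -> cuts_in c s -> nreg s 2 = 0%N ->
  (forall r, (r < n)%N -> best_below (is_cut c) n r (narr s 10 r)) ->
  exists t s' c', [/\ exec (While (rI < rN)%prog cut_step) s t s',
    static s', cuts_in c' s',
    (forall i, is_cut c i -> is_cut c' i) /\
    (forall r, (r < n)%N -> narr s 10 r != 0%N -> is_cut c' (narr s 10 r))
    & (t <= n.+1 * loop_cost (rI < rN)%prog cut_step)%N].
Proof.
move=> st cu i0 best; set X := is_cut c.
(* So far only components with root below k have received cuts, so [good_cut_local] applies to the
   edge selected for k. *)
pose I k s1 := [/\ static s1, nreg s1 2 = k /\ (k <= n)%N, narr s1 10 = narr s 10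
  & exists c', [/\ cuts_in c' s1, forall i, X i -> is_cut c' i,
      forall i, is_cut c' i -> X i \/ (rt X i < k)%N
    & forall r, (r < k)%N -> narr s 10 r != 0%N -> is_cut c' (narr s 10 r)]].
have [||k [t [s' [e [st' [ik kn] _ [c' [cu' sub _ all_cut]]] nb le]]]] :=
    @loop_rule _ (rI < rN)%prog cut_step n I isT _ s.
- move=> k s0 [st0 [ik kn] bE [c' [cu0 sub new all_cut]]].
  have [n0 D0 _ _ _] := st0; have [cutE ccE rec] := cu0.
  rewrite [beval _ _]/= n0 ik addn1 => lt; split=> //.
  rewrite /I [run _ _]/= ik bE.
  case: ifP => [b0|/negbT b0].
    split; [by []|by rewrite /= ik addn1|by rewrite /= bE|exists c'; split=> //].
      by move=> i /new [|h]; [left|right; exact: ltnW].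
    by move=> r; rewrite ltnS leq_eqVlt => /predU1P [->|/all_cut //]; rewrite b0.
  have [gb rb] := best_good D2 bl (best k lt) b0.
  set b := narr s 10 k in b0 gb rb *.
  have [|gb' rb'] := good_cut_local gb sub.
    by move=> i /new [|h]; [left|right; rewrite rb ltn_eqF].
  have [/andP [bpos bn] _ _] := gb'.
  split; [by []|by rewrite /= /update /= ik addn1|by rewrite /= /update /= bE|
    exists (b :: c'); split].
  + split.
    * move=> i lin; rewrite /= /update /= ?bE inE.
      by case: (eqVneq i b) => //= _; exact: cutE.
    * by rewrite /= /update /= ccE addn1.
    * rewrite /= /update /= ?bE ccE eqxx; split=> //; first by rewrite rb' rb.
      apply: recorded_ext rec => j jc; by rewrite /= (ltn_eqF jc).
  + by move=> i /sub ci; rewrite /is_cut inE -/(is_cut c' i) ci orbT.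
  + move=> i; rewrite /is_cut inE => /predU1P [->|/new [|h]]; [by right; rewrite rb|by left|].
    by right; exact: ltnW.
  + move=> r; rewrite ltnS leq_eqVlt => /predU1P [->|rk] rn; rewrite /is_cut inE ?eqxx //.
    by rewrite -/(is_cut c' _) all_cut // orbT.
- by split=> //; exists c; split=> // i; left.
exists t, s', c'; split=> //; split=> // r rn; apply: all_cut.
move: nb; rewrite [beval _ _]/= ik; case: st' => -> _ _ _ _.
by rewrite addn1 -leqNgt => nk; apply: leq_trans rn nk.
Qed.

Lemma round_correct c s m : static s -> cuts_in c s -> bound D F (is_cut c) m ->
  exists t s' c', [/\ exec cut_round s t s', static s', cuts_in c' s',
    bound D F (is_cut c') m.+1 & (t <= 1000 * n)%N].
Proof.
move=> st cu bd; have [n0 _ _ _ _] := st.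
have [t1 [s1 [e1 st1 cu1 [rts1 init1] le1]]] :=
  @root_loop _ _ _ _ _ F c (set_nreg s 2 0) st cu erefl.
have [t2 [s2 [e2 [st2 cu2] [rts2 szs2] b2 le2]]] :=
  @size_loop _ _ _ _ _ F n2 c (set_nreg s1 2 n) st1 cu1 erefl rts1 init1.
have [t3 [s3 [e3 st3 cu3 best3 le3]]] :=
  @select_loop c (set_nreg s2 2 1) st2 cu2 erefl rts2 szs2 b2.
have [t4 [s4 [c' [e4 st4 cu4 [sub cuts] le4]]]] :=
  @cut_loop c (set_nreg s3 2 0) st3 cu3 erefl best3.
exists (2 + (t1 + (2 + (t2 + (2 + (t3 + (2 + t4)))))))%N, s4, c'; split=> //.
- have [n1 _ _ _ _] := st1.
  have set2 s0 e : exec (NSet 2 e) s0 (ncost e).+1 (set_nreg s0 2 (neval s0 e)).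
    exact: ExecNSet.
  apply: ExecSeq (set2 s (NConst 0)) _; apply: ExecSeq e1 _.
  apply: ExecSeq (set2 s1 rN) _; rewrite [neval _ _]/= n1; apply: ExecSeq e2 _.
  apply: ExecSeq (set2 s2 (NConst 1)) _; apply: ExecSeq e3 _.
  exact: ExecSeq (set2 s3 (NConst 0)) e4.
- apply: bound_round (ltnW D2) sub _ bd => r rn rr big.
  have b0 : narr s3 10 r != 0%N.
    apply: contraTneq big => b0; rewrite -leqNgt.
    by apply: (best_none D2 bl); rewrite -b0; exact: best3.
  have [gb rb] := best_good D2 bl (best3 r rn) b0.
  by exists (narr s3 10 r); split; [exact: gb|exact: rb|exact: (cuts r rn b0)].
(* Four loops of at most n iterations with bodies of fixed cost, and four assignments; 1000 is a
   round upper bound. *)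
- rewrite /loop_cost /= in le1 le2 le3 le4.
  by clear -le1 le2 le3 le4 n2; lia.
Qed.

End RoundSelect.

(** * Rounds and assembly of the hierarchy *)

Section Assembly.
Variables (R : realType) (n : nat) (G : wgraph R n) (D : nat) (Lambda : R).
Variable F : rooting G.
Hypotheses (D2 : (2 <= D)%N) (n2 : (2 <= n)%N) (bl : balanced_light_edges G D Lambda).
Implicit Types (s : state R) (c : seq nat) (X : pred nat) (T : htree 'I_n).

Local Notation rt := (root (par F)).
Local Notation static := (static D F).
Local Notation cuts_in := (cuts_in D Lambda F).
Local Notation good_tree := (good_tree G D Lambda).

(** While fewer than n - 1 cuts are made, an edge is uncut, so [bound_uncut] and the property of h
    limit the number of rounds. The constant 1010 adds the test of the loop to the 1000 of a
    round. *)
Lemma rounds_correct s h : static s -> cuts_in [::] s ->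
  (forall m, (D ^ m <= D.-1 ^ m * n.-1)%N -> (m < h)%N) ->
  exists t s' c, [/\ exec (While (rCuts + NConst 1 < rN)%prog cut_round) s t s',
    static s', cuts_in c s', (n <= (size c).+1)%N & (t <= 1010 * n * h.+1)%N].
Proof.
move=> st cu hP.
pose b := (rCuts + NConst 1 < rN)%prog.
pose I k t s := [/\ static s, exists c, cuts_in c s /\ bound D F (is_cut c) k,
  (t <= k * (1010 * n))%N & (k <= h)%N].
have [||k [t [s' [e [st' [c [cu' _]] le kh] nb]]]] :=
  @while_rule _ b cut_round h I _ s.
- move=> k t s0 [st0 [c [cu0 bd]] le kh].
  have [n0 _ _ _ _] := st0; have [_ ccE rec] := cu0.
  rewrite [beval _ _]/= n0 ccE !addn1 => lt.
  have [i iin ic] := uncut_exists n2 lt.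
  have kh' : (k < h)%N by exact: hP (bound_uncut bd iin ic).
  split=> //; have [t' [s1 [c' [e1 st1 cu1 bd1 le1]]]] := round_correct D2 n2 bl st0 cu0 bd.
  exists t', s1; split=> //; split=> //; first by exists c'.
  rewrite /= mulSn; move: (k * _)%N le => u le; lia.
- by split=> //; exists [::]; split=> //; exact: bound0.
exists (t + bcost b)%N, s', c; split=> //.
  by move: nb; case: st' => + _ _ _ _; case: cu' => _ + _ /=; move=> -> ->; lia.
have : (k * (1010 * n) <= h * (1010 * n))%N by rewrite leq_mul2r kh orbT.
by rewrite mulnS [(_ * h)%N]mulnC /=; lia.
Qed.

(* Undoing the k-th cut creates the node n + k, so it leaves the trees made by
   undoing later cuts, whose nodes are at least lo = n + k + 1, untouched. *)
Fixpoint stored_from (lo : nat) (lft rgt : nat -> nat) (p : nat) T : Prop :=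
  match T with
  | HLeaf v => p = v
  | HNode T1 T2 => [/\ (lo <= p)%N, stored_from lo lft rgt (lft p) T1
                     & stored_from lo lft rgt (rgt p) T2]
  end.

Lemma stored_from_ext lo lo' lft rgt lft' rgt' p T : (lo' <= lo)%N ->
  (forall q, (lo <= q)%N -> lft' q = lft q /\ rgt' q = rgt q) ->
  stored_from lo lft rgt p T -> stored_from lo' lft' rgt' p T.
Proof.
move=> le ext; elim: T p => //= T1 IH1 T2 IH2 p [lop st1 st2].
have [-> ->] := ext p lop.
by split; [exact: leq_trans lop|exact: IH1|exact: IH2].
Qed.

Lemma stored_from_at s p T : stored_from n (narr s 2) (narr s 3) p T -> stored_at s p T.
Proof. by elim: T p => //= T1 IH1 T2 IH2 p [np /IH1 ? /IH2 ?]. Qed.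

(** Only current roots are constrained; a position that is no longer a root may keep an outdated
    tree in array 13. *)
Definition forest c s : Prop := forall r, (r < n)%N -> (r == 0)%N || is_cut c r ->
  exists T, [/\ stored_from (n + size c) (narr s 2) (narr s 3) (narr s 13 r) T,
    good_tree T, uniq (leaves T) & leaf_set T = cl F (is_cut c) r].

Lemma leaf_loop c s : static s -> cuts_in c s -> nreg s 2 = 0%N ->
  (n <= (size c).+1)%N ->
  exists t s', [/\ exec (While (rI < rN)%prog leaf_step) s t s',
    static s', cuts_in c s', forest c s'
    & (t <= n.+1 * loop_cost (rI < rN)%prog leaf_step)%N].
Proof.
move=> st cu i0 full.
pose I k s := [/\ static s, cuts_in c s, nreg s 2 = k
  & forall r, (r < k)%N -> (r < n)%N -> narr s 13 r = vtx F r].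
have [||k [t [s' [e [st' cu' ik leafE] nb le]]]] :=
    @loop_rule _ (rI < rN)%prog leaf_step n I isT _ s.
- move=> k s0 [st0 cu0 ik leafE]; have [n0 _ vE _ _] := st0.
  rewrite [beval _ _]/= n0 ik addn1 => lt; split=> //.
  split; [by []|by []|by rewrite /= /update /= ik addn1|].
  move=> r; rewrite ltnS /= /update /= ik leq_eqVlt.
  by case: (eqVneq r k) => [-> _ _|_ /= rk rn]; [rewrite vE|rewrite leafE].
- by [].
exists t, s'; split=> // r rn _; exists (HLeaf (vtx F r)).
have kn : (n <= k)%N.
  by move: nb; rewrite [beval _ _]/= ik; case: st' => -> _ _ _ _; rewrite addn1 -leqNgt.
split=> //; first by rewrite /= leafE // (leq_trans rn).
have [_ _ rec] := cu'.
rewrite (cl_all F (recorded_full n2 rec full) rn).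
by apply/setP => v; rewrite !finset.inE.
Qed.

Lemma join_loop c s : static s -> cuts_in c s -> forest c s ->
  exists t s', [/\ exec (While (NConst 0 < rCuts)%prog join_step) s t s',
    static s', forest [::] s'
    & (t <= n.+1 * loop_cost (NConst 0 < rCuts)%prog join_step)%N].
Proof.
move=> st cu fo.
pose I k s := [/\ static s & exists c', [/\ nreg s 6 = size c',
  recorded D Lambda F (narr s 11) (narr s 12) c', forest c' s & (k + size c' < n)%N]].
have [||k [t [s' [e [st' [c' [ccE _ fo' _]]] nb le]]]] :=
    @loop_rule _ (NConst 0 < rCuts)%prog join_step n I isT _ s.
- move=> k s0 [st0 [c' [ccE rec fo0 kn]]]; have [n0 _ _ _ _] := st0.
  rewrite [beval _ _]/= ccE add0n => lt.
  case: c' lt ccE rec fo0 kn => // b c' _ /= ccE [csE crE gc rec] fo0 kn.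
  split; first by lia.
  split=> //; exists c'; rewrite /= /update /= ccE n0 subn1 /= csE crE.
  split=> //; last by lia.
  have [/andP [b0 bn] bc _] := gc.
  set X := is_cut c' in gc bc fo0 *; have rb : (rt X b < b)%N by exact: root_cut_lt.
  have cutE : is_cut (b :: c') = cut X b by [].
  move=> r rn rroot; rewrite /= /update /=.
  have ext q : (n + (size c').+1 <= q)%N ->
      (if q == (n + size c')%N then narr s0 13 b else narr s0 2 q) = narr s0 2 q /\
      (if q == (n + size c')%N then narr s0 13 (rt X b) else narr s0 3 q) = narr s0 3 q.
    by move=> lo; rewrite gtn_eqF //; lia.
  case: (eqVneq r (rt X b)) => [->|ne].
    have [|T1 [st1 g1 u1 l1]] := fo0 b bn; first by rewrite cutE /cut eqxx orbT.
    have [|T2 [st2 g2 u2 l2]] := fo0 (rt X b) (ltn_trans rb bn).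
      by have := root_root_stop (par := par F) X b; rewrite cutE /cut => /orP [->|->];
        rewrite ?orbT.
    rewrite cutE in l1 l2.
    have [gT lT] := good_tree_join gc g1 g2 l1 l2.
    exists (HNode T1 T2); split=> //.
      rewrite /= eqxx; split; first by rewrite leqnn.
        by apply: stored_from_ext st1; [rewrite leq_add2l|exact: ext].
      by apply: stored_from_ext st2; [rewrite leq_add2l|exact: ext].
    rewrite /= cat_uniq u1 u2 andbT /=; apply/hasPn => v vT2; apply/negP => vT1.
    have v1 : v \in leaf_set T1 by rewrite finset.inE.
    have v2 : v \in leaf_set T2 by rewrite finset.inE.
    by have := disjointFr (cl_cut_disjoint F b0 bc) (x := v); rewrite -l1 -l2 v1 v2 => /(_ isT).
  have rb' : r != b.
    by apply/eqP => E; case/orP: rroot; rewrite E ?(gtn_eqF b0) //; apply/negP.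
  have [|T [st1 g1 u1 l1]] := fo0 r rn.
    by rewrite cutE /cut /X; case/orP: rroot => ->; rewrite ?orbT.
  exists T; split=> //; last by rewrite l1 cutE cl_cut_other.
  by apply: stored_from_ext st1; [rewrite leq_add2l|exact: ext].
- split=> //; exists c; have [_ ccE rec] := cu; split=> //.
  have [uc sub] := recorded_uniq n2 rec.
  by have := uniq_leq_size uc sub; rewrite size_iota add0n -ltnS prednK // ltnW.
exists t, s'; split=> //.
move: nb; rewrite [beval _ _]/= ccE add0n -leqNgt leqn0 => /nilP c0.
by rewrite c0 in fo'.
Qed.

Lemma build_hierarchy_correct s h : static s -> cuts_in [::] s ->
  (forall m, (D ^ m <= D.-1 ^ m * n.-1)%N -> (m < h)%N) ->
  exists t s' T, [/\ exec build_hierarchy s t s', output_tree s' T, is_hierarchy T,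
    good_tree T & (t <= 1500 * (n * h.+1))%N].
Proof.
move=> st cu hP.
have [t1 [s1 [c [e1 st1 cu1 full le1]]]] := rounds_correct st cu hP.
have [t2 [s2 [e2 st2 cu2 fo2 le2]]] :=
  @leaf_loop c (set_nreg s1 2 0) st1 cu1 erefl full.
have [t3 [s3 [e3 st3 fo3 le3]]] := join_loop st2 cu2 fo2.
have n0 : (0 < n)%N by exact: ltnW.
(* With all cuts undone, the component of position 0 is the whole vertex set. *)
have [T [stT gT uT lT]] := fo3 0%N n0 isT.
exists (t1 + (2 + (t2 + (t3 + 3))))%N, (set_nreg s3 0 (narr s3 13 0)), T; split=> //.
- apply: ExecSeq e1 _.
  have set0 s0 r e : exec (NSet r e) s0 (ncost e).+1 (set_nreg s0 r (neval s0 e)).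
    exact: ExecNSet.
  apply: ExecSeq (set0 s1 2 (NConst 0)) _; apply: ExecSeq e2 _; apply: ExecSeq e3 _.
  exact: (set0 s3 0 (NGet 13 (NConst 0))).
- apply: stored_from_at; rewrite /= /update /=.
  by apply: stored_from_ext stT => //; rewrite addn0.
- apply: uniq_perm; rewrite ?enum_uniq // => v; rewrite mem_enum.
  have : v \in leaf_set T by rewrite lT cl_none finset.inE.
  by rewrite finset.inE.
- rewrite /loop_cost /= in le1 le2 le3.
  have : (n <= n * h.+1)%N by rewrite leq_pmulr.
  move: le1; rewrite -mulnA; move: (n * h.+1)%N => u le1 nu.
  by clear -le1 le2 le3 nu n2; lia.
Qed.

End Assembly.

(** * Breadth-first search *)

Lemma nth_flatten_take (A : Type) (x0 : A) (ss : seq (seq A)) i j :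
  (i < size ss)%N -> (j < size (nth [::] ss i))%N ->
  nth x0 (flatten ss) (sumn (take i (shape ss)) + j) = nth x0 (nth [::] ss i) j.
Proof.
elim: ss i => [|s ss IH] [|i] //= isz jsz; rewrite nth_cat; first by rewrite add0n jsz.
by rewrite -addnA ltnNge leq_addr /= addKn IH.
Qed.

Lemma sumn_take_next (s : seq nat) i : (i < size s)%N ->
  sumn (take i.+1 s) = (sumn (take i s) + nth 0 s i)%N.
Proof. by move=> lt; rewrite (take_nth 0%N) // sumn_rcons. Qed.

Section Spanning.
Variables (R : realType) (n : nat) (G : wgraph R n) (v0 : 'I_n).

(* A tree edge outside of a spanning subtree would close a cycle. *)
Lemma tree_rooting (q : seq 'I_n) (p : nat -> nat) : is_tree G ->
  uniq q -> size q = n ->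
  (forall k, (0 < k < n)%N -> (p k < k)%N /\ adj G (nth v0 q k) (nth v0 q (p k))) ->
  exists F : rooting G,
    (forall k, (k < n)%N -> par F k = p k) /\
    (forall k, (k < n)%N -> vtx F k = nth v0 q k).
Proof.
move=> [con acyclic] uq szq pP.
pose p' k := if (k < n)%N then p k else 0%N.
have p'lt k : (0 < k)%N -> (p' k < k)%N.
  by rewrite /p' => k0; case: ifP => // kn; apply: (pP k _).1; rewrite k0.
have memq v : v \in q.
  have sub : {subset q <= enum 'I_n} by move=> x _; rewrite mem_enum.
  have [|_ eqi] := uniq_min_size uq sub; first by rewrite -cardE card_ord szq.
  by rewrite eqi mem_enum.
pose pos v := index v q.
have pos_lt v : (pos v < n)%N by rewrite -[X in (_ < X)%N]szq index_mem.
have posK v : nth v0 q (pos v) = v by rewrite nth_index.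
have vtxK i : (i < n)%N -> pos (nth v0 q i) = i by move=> lin; rewrite /pos index_uniq ?szq.
pose half u v := ((0 < pos u) && (pos v == p' (pos u)))%N.
pose e : rel 'I_n := [rel u v | half u v || half v u].
have half_adj u v : half u v -> adj G u v.
  case/andP=> u0 /eqP pE; have un : (0 < pos u < n)%N by rewrite u0 pos_lt.
  have [_] := pP _ un; rewrite posK.
  have -> : p (pos u) = pos v by rewrite pE /p' pos_lt.
  by rewrite posK.
have e_adj : subrel e (adj G).
  by move=> u v /orP [/half_adj //|/half_adj]; rewrite adj_sym.
have e_sym : symmetric e by move=> u v; rewrite /e /= orbC.
have con0 v : connect e v (nth v0 q 0).
  rewrite -{1}(posK v); move: (pos_lt v); elim/ltn_ind: (pos v) => -[|k] IH kn.
    exact: connect0.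
  have lt := p'lt k.+1 isT; have pn := ltn_trans lt kn.
  by apply: connect_trans (IH _ lt pn); apply: connect1; rewrite /e /= /half !vtxK // eqxx.
have adjE u v : adj G u v = e u v.
  apply/idP/idP => [uv|/e_adj //].
  have : connect e u v.
    by apply: connect_trans (con0 u) _; rewrite (sym_connect_sym e_sym).
  case/connectP => r ur vE; case/shortenP: ur vE => r' ur' ur'_uniq _ vE.
  case: r' ur' ur'_uniq vE => [|x [|y r']] ur' uniq_r' vE.
  - by rewrite vE /= adj_irr in uv.
  - by rewrite vE /=; case/andP: ur'.
  have /= := acyclic (u :: x :: y :: r'); rewrite /ucycle uniq_r' andbT /cycle rcons_path.
  by rewrite (sub_path e_adj ur') -vE adj_sym uv => /(_ isT).
pose F := @Rooting R n G (ParentMap p'lt) pos (nth v0 q) pos_lt posK vtxK adjE.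
by exists F; split=> // k kn; rewrite /= /p' kn.
Qed.
End Spanning.

Section Search.
Variables (R : realType) (n : nat) (G : wgraph R n) (D : nat).
Variable L : 'I_n -> seq 'I_n.
Hypotheses (n2 : (2 <= n)%N) (tree : is_tree G) (lists : adjacency_lists G L).
Implicit Types (s : state R) (q r : seq 'I_n).

Local Notation input := (input_state G D L).

Definition degrees : seq nat := [seq size (L x) | x <- enum 'I_n].
Definition offset (k : nat) : nat := sumn (take k degrees).

Lemma nth_degrees (v : 'I_n) : nth 0%N degrees v = size (L v).
Proof. by rewrite (nth_map v) ?size_enum_ord // nth_ord_enum. Qed.

Lemma offset_next (v : 'I_n) : offset v.+1 = (offset v + size (L v))%N.
Proof. by rewrite /offset sumn_take_next ?nth_degrees // size_map size_enum_ord. Qed.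

Lemma input_nth (A : Type) (a0 : A) (f : 'I_n -> 'I_n -> A) (v v0 : 'I_n) j :
  (j < size (L v))%N ->
  nth a0 (flatten [seq [seq f x y | y <- L x] | x <- enum 'I_n]) (offset v + j)
    = f v (nth v0 (L v) j).
Proof.
move=> jv; set ss := [seq _ | x <- _].
have shapeE : shape ss = degrees.
  by rewrite /shape /ss -map_comp; apply: eq_map => x /=; rewrite size_map.
have ssv : nth [::] ss v = [seq f v y | y <- L v].
  by rewrite (nth_map v) ?size_enum_ord // nth_ord_enum.
have vss : (v < size ss)%N by rewrite /ss size_map size_enum_ord.
have jss : (j < size (nth [::] ss v))%N by rewrite ssv size_map.
by rewrite /offset -shapeE nth_flatten_take // ssv (nth_map v0).
Qed.

Let v0 : 'I_n := Ordinal (ltnW n2).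

(** Register 6 and array 7 are included because the rounds start from an empty list of cuts. *)
Definition input_kept s : Prop :=
  [/\ [/\ nreg s 0 = n, nreg s 1 = D & nreg s 6 = 0%N], narr s 0 = offset,
      narr s 1 = narr input 1, warr s 0 = warr input 0 & forall i, narr s 7 i = 0%N].

(** The list q is both the queue and the search order: it contains the scanned and the waiting
    vertices as discovered. *)
Definition spanned q s : Prop :=
  [/\ nreg s 4 = size q, uniq q /\ (0 < size q)%N,
      forall k, (k < size q)%N -> narr s 4 k = nth v0 q k,
      forall u : 'I_n, (narr s 6 u == 0)%N = (u \notin q)
    & forall k, (0 < k < size q)%N -> [/\ (narr s 5 k < k)%N,
        adj G (nth v0 q k) (nth v0 q (narr s 5 k))
      & warr s 1 k = wt G (nth v0 q k) (nth v0 q (narr s 5 k))]].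

Lemma spanned_size q s : spanned q s -> (size q <= n)%N.
Proof.
case=> _ [uq _] _ _ _; rewrite -(card_uniqP uq) -[X in (_ <= X)%N](card_ord n).
exact: max_card.
Qed.

Lemma visit_loop q s i : input_kept s -> spanned q s -> nreg s 2 = i -> (i < size q)%N ->
  let v := nth v0 q i in
  nreg s 3 = offset v -> nreg s 5 = offset v.+1 ->
  exists t s', [/\ exec (While (rJ < rEnd)%prog bfs_visit) s t s', input_kept s',
    nreg s' 2 = i, exists r, spanned (q ++ r) s' /\ {subset L v <= q ++ r}
    & (t <= (size (L v)).+1 * loop_cost (rJ < rEnd)%prog bfs_visit)%N].
Proof.
move=> ik sp iE iq v jE endE.
pose I k s := [/\ input_kept s, nreg s 2 = i, nreg s 3 = (offset v + k)%N,
  nreg s 5 = (offset v + size (L v))%N /\ (k <= size (L v))%N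
  & exists r, spanned (q ++ r) s /\ forall j, (j < k)%N -> nth v0 (L v) j \in q ++ r].
have [||k [t [s' [e [ik' iE' jE' [endE' kn] [r [sp' sub]]] nb le]]]] :=
    @loop_rule _ (rJ < rEnd)%prog bfs_visit (size (L v)) I isT _ s.
- move=> k s0 [ik0 iE0 jE0 [endE0 kn] [r [sp0 sub]]].
  rewrite [beval _ _]/= jE0 endE0 addn1 -addnS leq_add2l => lt; split=> //.
  have [_ _ adjE wtE cutE] := ik0.
  have [cntE [uq q0] ordE visE parE] := sp0.
  set u := nth v0 (L v) k.
  have uE : narr s0 1 (offset v + k) = u.
    by rewrite adjE /= (@input_nth _ _ (fun _ y => val y) v v0).
  have wE : warr s0 0 (offset v + k) = wt G v u by rewrite wtE /= (@input_nth _ _ _ v v0).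
  have [uqL memL] := lists v.
  have vu : adj G v u by rewrite -[adj G v u]memL mem_nth.
  have extend r' : u \in q ++ r' -> (forall x, x \in q ++ r -> x \in q ++ r') ->
      forall j, (j < k.+1)%N -> nth v0 (L v) j \in q ++ r'.
    by move=> uq' sub' j; rewrite ltnS leq_eqVlt => /predU1P [->//|/sub /sub'].
  rewrite /I [run _ _]/= jE0 uE visE.
  case: ifP => [uN|/negbFE uq'].
    have vq : v \in q ++ r by rewrite mem_cat mem_nth.
    have vi : nth v0 (q ++ r) i = v by rewrite nth_cat iq.
    have iqr : (i < size (q ++ r))%N by rewrite size_cat ltn_addr.
    split.
    + by [].
    + by rewrite /= /update /= iE0.
    + by rewrite /= /update /= jE0 addn1 addnS.
    + by rewrite /= /update /= endE0.
    + exists (rcons r u); rewrite -rcons_cat; split; last first.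
        move=> j jk; rewrite rcons_cat; apply: extend jk => [|x xqr].
          by rewrite -rcons_cat mem_rcons inE eqxx.
        by rewrite -rcons_cat mem_rcons inE xqr orbT.
      split.
      * by rewrite /= /update /= cntE size_rcons addn1.
      * by rewrite rcons_uniq uN uq size_rcons.
      * move=> j; rewrite size_rcons ltnS /= /update /= cntE ?jE0 ?uE nth_rcons leq_eqVlt.
        by case: (eqVneq j) => [-> _|_ /= jq]; [rewrite ltnn ?eqxx|rewrite jq ordE].
      * move=> x; rewrite /= /update /= ?jE0 ?uE mem_rcons inE negb_or.
        by case: (eqVneq (x : nat) u) => [/ord_inj ->|ne] /=; [rewrite eqxx|rewrite -visE;
          case: (eqVneq x u) ne => // ->; rewrite eqxx].
      * move=> j; rewrite size_rcons => /andP [j0 jle]; rewrite /= /update /= ?cntE ?jE0 ?iE0.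
        case: (eqVneq j (size (q ++ r))) => [->|ne].
          rewrite nth_rcons ltnn eqxx nth_rcons iqr vi wE; split=> //; first by rewrite adj_sym.
          exact: wt_sym.
        have jq : (j < size (q ++ r))%N by rewrite ltn_neqAle ne.
        have [lt1 a1 w1] := parE j (introT andP (conj j0 jq)).
        by rewrite !nth_rcons jq (ltn_trans lt1 jq).
  split; [by []|by []|by rewrite /= /update /= jE0 addn1 addnS|by []|].
  by exists r; split=> //; exact: extend.
- split=> //; first by rewrite addn0.
    by rewrite endE offset_next.
  by exists [::]; rewrite cats0.
exists t, s'; split=> //; exists r; split=> // u uL.
have kE : k = size (L v).
  by move: nb; rewrite [beval _ _]/= jE' endE'; lia.
by rewrite -(nth_index v0 uL); apply: sub; rewrite kE index_mem.
Qed.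


(** Each adjacency links a position to its parent in one of the two directions, and each position
    has one parent. The lemma serves to bound the time of the search that yields F. *)
Lemma degree_sum (F : rooting G) : (\sum_v size (L v) <= 2 * n)%N.
Proof.
have sizeE v : size (L v) = (\sum_u adj G v u)%N.
  have [uqL memL] := lists v.
  rewrite -(card_uniqP uqL) (eq_card memL) -sum1_card big_mkcond /=.
  by apply: eq_bigr => u _; rewrite -topredE /=; case: (adj G v u).
have pos_inj : injective (pos F) := can_inj (posK F).
have at_most1 k : (\sum_(u : 'I_n) (pos F u == k) <= 1)%N.
  have [kn|kn] := ltnP k n.
    rewrite (bigD1 (vtx F k)) //= vtxK // eqxx big1 // => u ne.
    by case: eqP => // E; move: ne; rewrite -E posK eqxx.
  by rewrite big1 // => u _; rewrite ltn_eqF // (leq_trans (pos_lt F u)).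
have adj_le v u : (adj G v u <= (pos F u == par F (pos F v)) + (pos F v == par F (pos F u)))%N.
  rewrite (adj_par F) (eq_sym (pos F u)) (eq_sym (pos F v)) [par F _ == _]eq_sym.
  by rewrite [par F (pos F u) == _]eq_sym; case: (_ == _); case: (_ == _);
    rewrite ?andbT ?andbF //; case: (0 < _)%N => //; case: (0 < _)%N.
apply: leq_trans (_ : \sum_v (\sum_u ((pos F u == par F (pos F v)) +
    (pos F v == par F (pos F u)))) <= _)%N.
  by apply: leq_sum => v _; rewrite sizeE; apply: leq_sum => u _.
have card_n : (\sum_(v : 'I_n) 1 = n)%N by rewrite sum1_card card_ord.
under eq_bigr do rewrite big_split /=.
rewrite big_split /= mul2n -addnn [X in (_ + X)%N]exchange_big /=.
by apply: leq_add; rewrite -[leqRHS]card_n; apply: leq_sum => v _; exact: at_most1.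
Qed.

Lemma scan_loop s : input_kept s -> spanned [:: v0] s -> nreg s 2 = 0%N ->
  exists t s' q, [/\ exec (While (rI < rSeen)%prog bfs_scan) s t s', input_kept s',
    spanned q s', forall u v, u \in q -> adj G u v -> v \in q
    & (t <= 100 * size q + 100 + 100 * \sum_(v <- q) size (L v))%N].
Proof.
move=> ik sp i0.
pose b := (rI < rSeen)%prog.
(* The first k vertices have been scanned. Scanning v costs a constant plus a multiple of its
   degree, so the time is kept as a sum over the scanned vertices. *)
pose I k t s := [/\ input_kept s, nreg s 2 = k & exists q, [/\ spanned q s, (k <= size q)%N,
  forall u v, u \in take k q -> adj G u v -> v \in q
  & (t <= 100 * k + 100 * \sum_(v <- take k q) size (L v))%N]].
have [||k [t [s' [e [ik' kE [q [sp' kq closed le]]] nb]]]] := @while_rule _ b bfs_scan n I _ s.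
- move=> k t s0 [ik0 kE [q [sp0 kq closed le]]].
  have [cntE _ ordE _ _] := sp0; have [_ offE _ _ _] := ik0.
  rewrite [beval _ _]/= kE cntE addn1 => lt.
  split; first exact: leq_trans lt (spanned_size sp0).
  set v := nth v0 q k.
  have [t1 e1 le1] := run_exec (c := bfs_start) s0 isT.
  have j1 : nreg (run bfs_start s0) 3 = offset v.
    by rewrite /= /update /= kE ordE // offE.
  have end1 : nreg (run bfs_start s0) 5 = offset v.+1.
    by rewrite /= /update /= kE ordE // offE addn1.
  have [t2 [s2 [e2 ik2 k2E [r [sp2 sub]] le2]]] :=
    @visit_loop q (run bfs_start s0) k ik0 sp0 kE lt j1 end1.
  exists (t1 + (t2 + 4))%N, (set_nreg s2 2 k.+1); split.
    apply: ExecSeq e1 _; apply: ExecSeq e2 _.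
    by rewrite -[k.+1]addn1 -[X in (X + 1)%N]k2E; exact: ExecNSet.
  split=> //; exists (q ++ r).
  have takeE : take k.+1 (q ++ r) = rcons (take k q) v.
    by rewrite takel_cat // (take_nth v0).
  split=> //.
  + by rewrite size_cat (leq_trans lt) ?leq_addr.
  + move=> u w; rewrite takeE mem_rcons inE => /predU1P [->|uq] uw.
      by apply: sub; rewrite (lists v).2.
    by rewrite mem_cat (closed u w uq uw).
  rewrite takeE -cats1 big_cat /= big_seq1.
  rewrite /loop_cost /= in le1 le2 *.
  move: (\sum_(x <- _) _)%N le => S le; rewrite -/v in le2.
  move: (size (L v)) le2 => d le2.
  by clear -le le1 le2; lia.
- by split=> //; exists [:: v0]; split.
exists (t + bcost b)%N, s', q.
have kE' : k = size q.
  by move: nb; rewrite [beval _ _]/= kE; case: sp' => -> _ _ _ _; lia.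
rewrite kE' take_size in le closed; split=> //.
by rewrite /=; clear -le; lia.
Qed.

Lemma bfs_correct Lambda : exists t s' (F : rooting G), [/\ exec bfs input t s',
  static D F s', cuts_in D Lambda F [::] s' & (t <= 600 * n)%N].
Proof.
pose c0 := Seq (NPut 6 (NConst 0) (NConst 1)) (NSet 4 (NConst 1)).
have [t0 e0 le0] := run_exec (c := c0) input isT.
have [|||t1 [s1 [q [e1 ik1 sp1 closed le1]]]] := @scan_loop (run c0 input).
- by split.
- split=> //.
  + by case.
  + move=> u; rewrite /= /update /= inE.
    by case: (eqVneq u v0) => [-> //|ne]; case: (eqVneq (u : nat) 0%N) => // E;
      case/eqP: ne; apply: val_inj.
  + by case=> [|k].
- by [].
have [n1 [uq q0] ordE _ parE] := sp1.
(* The set q is non-empty and closed under adjacency, and the graph is connected. *)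
have memq u : u \in q.
  have cl_q : fingraph.closed (adj G) (mem q).
    by move=> x y xy; apply/idP/idP => h; apply: closed h _; rewrite // adj_sym.
  by rewrite -(closed_connect cl_q (tree.1 (nth v0 q 0) u)) mem_nth.
have szq : size q = n.
  by rewrite -(card_uniqP uq) -[RHS](card_ord n); apply: eq_card => u; rewrite memq.
have [|F [FparE FvtxE]] := @tree_rooting _ _ _ v0 q (narr s1 5) tree uq szq.
  by rewrite -{1}szq => k /parE [].
have [[nE DE ccE] _ _ _ cutE] := ik1.
exists (t0 + t1)%N, s1, F; split.
- exact: ExecSeq e0 e1.
- split=> // [i lin|i lin|i /andP [i0 lin]].
  + by rewrite FvtxE // ordE // szq.
  + by rewrite FparE.
  + have := parE i; rewrite szq i0 lin => /(_ isT) [plt _ ->].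
    by rewrite /edge_wt FparE // !FvtxE // (ltn_trans plt).
- by split=> // i _; rewrite cutE.
- have sumE : (\sum_(v <- q) size (L v) <= 2 * n)%N.
    rewrite big_uniq //=; apply: leq_trans (degree_sum F).
    by apply: eq_leq; apply: eq_bigl => v; rewrite memq.
  move: le1; rewrite szq; move: (\sum_(v <- q) _)%N sumE => S sumE le1.
  rewrite /= in le0; clear -le0 le1 sumE n2; lia.
Qed.

End Search.

(** * The theorem *)

Section Bounds.
Variables (R : realType) (n : nat) (G : wgraph R n) (D : nat) (Lambda : R).
Hypotheses (D2 : (2 <= D)%N) (n2 : (2 <= n)%N) (tree : is_tree G).
Hypothesis bl : balanced_light_edges G D Lambda.

Lemma program_correct (L : 'I_n -> seq 'I_n) h : adjacency_lists G L -> (0 < h)%N ->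
  (forall m, (D ^ m <= D.-1 ^ m * n.-1)%N -> (m < h)%N) ->
  exists t s T, [/\ exec hierarchy_program (input_state G D L) t s, output_tree s T,
    is_hierarchy T, good_tree G D Lambda T & (t <= 4000 * (n * h))%N].
Proof.
move=> lists h0 hP.
have [t1 [s1 [F [e1 st cu le1]]]] := bfs_correct D n2 tree lists Lambda.
have [t2 [s2 [T [e2 outT hT gT le2]]]] := build_hierarchy_correct D2 n2 bl st cu hP.
exists (t1 + t2)%N, s2, T; split=> //; first exact: ExecSeq e1 e2.
(* The search costs 600 n and the rest 1500 n (h + 1) <= 3000 n h, as h >= 1. *)
have : (n <= n * h)%N by rewrite leq_pmulr.
move: le2; rewrite mulnS; move: (n * h)%N => u; clear -le1; lia.
Qed.

(** For S = V the hypothesis bounds a positive weight by Lambda times a nonnegative number. The sign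
    is needed to multiply inequalities by Lambda H. *)
Lemma Lambda_gt0 : 0 < Lambda.
Proof.
have full : (2 <= #|[set: 'I_n]%SET|)%N by rewrite cardsT card_ord.
have [a [b [ab _ light]]] := bl (is_tree_connected_on tree) full.
have w0 : 0 < wt G a b by case/and3P: ab => _ _; exact: wt_gt0.
have := lt_le_trans w0 light; apply: contraTT; rewrite -!leNgt => L0.
apply: mulr_le0_ge0 => //; apply: divr_ge0; first exact: set_weight_ge0.
by rewrite subr_ge0 ler1n (ltnW full).
Qed.

Lemma dist_lt_n x y : (dist G x y <= n.-1)%N.
Proof.
have := dist_connected_on (is_tree_connected_on tree) (finset.in_setT x) (finset.in_setT y).
by rewrite cardsT card_ord.
Qed.

Lemma hierarchy_bounds T h : (0 < h)%N ->
  (forall m, (D ^ m <= D.-1 ^ m * n.-1)%N -> (m < h)%N) ->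
  is_hierarchy T -> good_tree G D Lambda T ->
  exists optF optC : R, [/\ is_OPT_free G optF, is_OPT_card G optC,
    costD G T <= Lambda * h%:R * total_weight G,
    Lambda * h%:R * total_weight G <= Lambda * h%:R * optF
  & Lambda * h%:R * optF <= Lambda * h%:R * optC].
Proof.
move=> h0 hP hT gT.
have L0 := ltW Lambda_gt0; have uT := uniq_hierarchy hT.
have allT : leaf_set T = [set: 'I_n]%SET.
  by apply/setP => x; rewrite !finset.inE mem_hierarchy.
have dom : dominates_dist G (card_ultra R T).
  move=> x y; rewrite /card_ultra; case: eqVneq => [->|_].
    have := @dist_le_path _ _ G y [::] isT (ltnW n2).
    by rewrite /= leqn0 => /eqP ->.
  have xT := mem_hierarchy x hT; have yT := mem_hierarchy y hT.
  rewrite lerBrDr natr1 ler_nat -(prednK (card_cluster_gt0 xT yT)) ltnS.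
  exact: (card_ultra_dominates uT gT).
have [optF [optC [isF isC leF leC]]] := OPT_chain hT dist_lt_n dom.
have Lh : 0 <= Lambda * h%:R by rewrite mulr_ge0.
exists optF, optC; split=> //; [|exact: ler_wpM2l|exact: ler_wpM2l].
rewrite costDE //.
have -> : total_weight G = set_weight G (leaf_set T).
  by apply: eq_bigl => p; rewrite /induced allT /= !finset.in_setT.
apply: (good_tree_cost D2 L0 uT gT).
(* If the depth condition failed at k = h, the property of h would give h < h. *)
rewrite allT cardsT card_ord ltnNge mulnC; apply/negP => /hP.
by rewrite ltnn.
Qed.

End Bounds.

Lemma depth_bound_ln (R : realType) D : (2 <= D)%N ->
  exists2 c : R, 0 <= c & forall n, (2 <= n)%N ->
    (depth_bound R n D)%:~R <= c * ln (n%:R : R).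
Proof.
move=> D2; set q : R := D%:R / (D%:R - 1).
have q1 : 1 < q.
  have D1 : 0 < D%:R - 1 :> R by rewrite subr_gt0 ltr1n.
  by rewrite /q ltr_pdivlMr // mul1r ltrBlDr ltrDl ltr01.
have lq : 0 < ln q by exact: ln_gt0.
have l2 : 0 < ln (2%:R : R) by apply: ln_gt0; rewrite ltr1n.
(* The summand 1 is at most ln n / ln 2 since n >= 2, and the floor is at most ln n / ln q. *)
exists ((ln (2%:R : R))^-1 + (ln q)^-1); first by rewrite addr_ge0 // invr_ge0 ltW.
move=> n n2.
rewrite /depth_bound rmorphD /= mulrDl; apply: lerD.
  by rewrite mulrC ler_pdivlMr // mul1r ler_ln ?posrE ?ltr0n ?ler_nat // ltnW.
apply: le_trans (_ : ln (n%:R - 1) / ln q <= _); first exact: floor_le.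
rewrite mulrC ler_pM2l ?invr_gt0 // ler_ln ?posrE.
- by rewrite gerBl.
- by rewrite subr_gt0 ltr1n.
- by rewrite ltr0n ltnW.
Qed.

Theorem corollary13 (R : realType) :
  exists P : cmd,
    (exists C : R, forall (D : nat) (Lambda : R) (n : nat) (G : wgraph R n)
        (L : 'I_n -> seq 'I_n),
      (2 <= D)%N -> (2 <= n)%N -> is_tree G -> max_degree_le G D ->
      balanced_light_edges G D Lambda -> adjacency_lists G L ->
      let H : R := (depth_bound R n D)%:~R in
      exists (t : nat) (s : state R) (T : htree 'I_n),
        [/\ exec P (input_state G D L) t s,
            output_tree s T,
            is_hierarchy T,
            t%:R <= C * (n%:R * H)
          & exists optF optC : R,
              [/\ is_OPT_free G optF,
                  is_OPT_card G optC,
                  costD G T <= Lambda * H * total_weight G,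
                  Lambda * H * total_weight G <= Lambda * H * optF
                & Lambda * H * optF <= Lambda * H * optC]])
    /\
    (forall D : nat, (2 <= D)%N ->
      exists C : R, forall (Lambda : R) (n : nat) (G : wgraph R n)
        (L : 'I_n -> seq 'I_n) (t : nat) (s : state R),
      (2 <= n)%N -> is_tree G -> max_degree_le G D ->
      balanced_light_edges G D Lambda -> adjacency_lists G L ->
      exec P (input_state G D L) t s ->
      t%:R <= C * (n%:R * ln (n%:R : R))).
Proof.
exists hierarchy_program; split.
  exists 4000%:R => D Lambda n G L D2 n2 tree _ bl lists H.
  have [h [HE h0 hP]] := depth_bound_nat R D2 n2.
  have [t [s [T [e outT hT gT le]]]] := program_correct D2 n2 tree bl lists h0 hP.
  exists t, s, T; split=> //.
    by rewrite /H HE -!natrM ler_nat.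
  by rewrite /H HE; exact: (hierarchy_bounds D2 n2 tree bl h0 hP hT gT).
move=> D D2; have [c c0 cP] := depth_bound_ln R D2.
exists (4000%:R * c) => Lambda n G L t s n2 tree _ bl lists e.
have [h [HE h0 hP]] := depth_bound_nat R D2 n2.
have [t' [s' [T [e' _ _ _ le]]]] := program_correct D2 n2 tree bl lists h0 hP.
have [-> _] := exec_det e e'.
apply: le_trans (_ : (4000 * (n * h))%:R <= _); first by rewrite ler_nat.
rewrite !natrM -mulrA ler_pM2l ?ltr0n // mulrCA ler_wpM2l ?ler0n //.
by rewrite -HE cP.
Qed.
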